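(* Suppose $X_j=T_j(Z_j)$, $1\le j\le p$, for a pairwise Gaussian vector $(Z_1,\ldots,Z_p)$ with correlation matrix $\mathrm{Corr}(Z_1,\ldots,Z_p)=\Sigma^z$ and some deterministic functions $T_j$ with $0<\mathrm{Var}(T_j(Z_j))<\infty$. Then, both for ($q=2$, $\mathcal J=\{1,\ldots,p\}$) and for ($q=1$, $\mathcal J=\mathcal I$), the quantity $$\phi^*=\inf\left\{\frac{|\mathcal I|^{2-q}\big\|\sum_{j=1}^pf_j(X_j)\big\|^2_{L_2^{(0)}(\mathbb P)}}{\Big(\sum_{j\in\mathcal J}\|f_j(X_j)\|^q_{L_2^{(0)}(\mathbb P)}\Big)^{2/q}}:\ \frac{\sum_{j\in\mathcal I}\mathrm{Pen}_j(f_j)}{\sum_{j\in\mathcal I^c}\mathrm{Pen}_j(f_j)}>\xi_0\right\}$$ satisfies $\phi^*\ge\kappa_0$ with $\kappa_0=\lambda_{\min}(\Sigma^z)$. In particular, the theoretical restricted eigenvalue condition (case $q=2$, $\mathcal J=\{1,\ldots,p\}$) and the theoretical compatibility condition (case $q=1$, $\mathcal J=\mathcal I$), i.e. $\phi^*\ge\kappa_0$ with a positive constant $\kappa_0$, hold when $\lambda_{\min}(\Sigma^z)$ is bounded away from zero.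
   Context: A random vector $(Z_1,\ldots,Z_p)$ is pairwise Gaussian if $(Z_j,Z_k)$ is bivariate Gaussian for all pairs $(j,k)$. $\|f\|_{L_2^{(0)}(\mathbb P)}$ is the semi-norm with $\|f\|^2_{L_2^{(0)}(\mathbb P)}=\mathrm{Var}(f(X_1,\ldots,X_p))$. $\mathcal I\subseteq\{1,\ldots,p\}$ is a nonempty index set (of nonzero components of an additive model), $\mathcal I^c$ its complement, $\xi_0>0$ a constant, and $\mathrm{Pen}_j(f_j)\ge0$ is a penalty function of $f_j$ (typically a norm). The infimum is over tuples $(f_1,\ldots,f_p)$ of functions with $\mathrm{Var}(f_j(X_j))<\infty$ satisfying the stated constraint and for which the denominator in the objective is positive. In the penalty quotient the convention $0/0=0$ is used. $\lambda_{\min}$ is the smallest eigenvalue. *)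

(* Defs.v *)
From HB Require Import structures.
From mathcomp Require Import all_boot all_order all_algebra.
From mathcomp Require Import all_classical all_reals all_analysis.

Set Implicit Arguments.
Unset Strict Implicit.
Unset Printing Implicit Defensive.

Import Order.TTheory GRing.Theory Num.Theory.
Import numFieldNormedType.Exports.

Local Open Scope classical_set_scope.
Local Open Scope ring_scope.

(** Built on MathComp-Analysis. *)

Section Gaussian.
Context {d : measure_display} {T : measurableType d} {R : realType}.
Variable P : probability T R.

(** The joint law of [(Y, Z)] is that of an affine map of a pair [(u.1, u.2)]
    of independent standard normals.  The linear part may be singular, so
    degenerate Gaussian laws (e.g. that of [(Y, Y)]) are included. *)
Definition bivariate_gaussian (Y Z : T -> R) : Prop :=
  exists m1 m2 a11 a12 a21 a22 : R,
    forall A : set (R * R), measurable A ->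
      pushforward P (fun w => (Y w, Z w)) A =
      pushforward (normal_prob (0 : R) 1 \x normal_prob (0 : R) 1)%E
        (fun u : R * R => (m1 + a11 * u.1 + a12 * u.2,
                           m2 + a21 * u.1 + a22 * u.2)) A.

(** The diagonal pairs [j = k] say that each [Z j] is Gaussian; this only adds
    something to the pairs [j != k] when [p = 1]. *)
Definition pairwise_gaussian (p : nat) (Z : 'I_p -> T -> R) : Prop :=
  forall j k : 'I_p, bivariate_gaussian (Z j) (Z k).

Definition correlation (Y Z : T -> R) : R :=
  fine (covariance P Y Z) /
    (Num.sqrt (fine ('V_P[Y])) * Num.sqrt (fine ('V_P[Z]))).

Definition corr_mx (p : nat) (Z : 'I_p -> T -> R) : 'M[R]_p :=
  \matrix_(j, k) correlation (Z j) (Z k).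

End Gaussian.

(** Used for symmetric [A] of positive size, whose spectrum is finite and
    nonempty, so that the infimum is attained. *)
Definition lambda_min (R : realType) (p : nat) (A : 'M[R]_p) : R :=
  inf [set l : R | eigenvalue A l].

Section RestrictedEigenvalue.
Context {d : measure_display} {T : measurableType d} {R : realType}.
Variable P : probability T R.

Definition L20_norm (Y : T -> R) : R := Num.sqrt (fine ('V_P[Y])).

Variables (p : nat) (X : 'I_p -> T -> R) (I : {set 'I_p}).
Variables (Pen : 'I_p -> (R -> R) -> R) (xi0 : R).

(** Extended-real division: [a / 0 = +oo] for [a > 0], and [0 / 0 = 0]. *)
Definition pen_quotient (f : 'I_p -> R -> R) : \bar R :=
  ((\sum_(j in I) Pen j (f j))%:E / (\sum_(j in ~: I) Pen j (f j))%:E)%E.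

Definition phi_denominator (q : R) (J : {set 'I_p}) (f : 'I_p -> R -> R) : R :=
  (\sum_(j in J) L20_norm (f j \o X j) `^ q) `^ (2 / q).

Definition phi_objective (q : R) (J : {set 'I_p}) (f : 'I_p -> R -> R) : R :=
  #|I|%:R `^ (2 - q) * L20_norm (fun w => \sum_(j < p) f j (X j w)) ^+ 2
    / phi_denominator q J f.

Definition phi_admissible (q : R) (J : {set 'I_p}) (f : 'I_p -> R -> R) : Prop :=
  [/\ forall j, measurable_fun setT (f j),
      forall j, ('V_P[f j \o X j] < +oo)%E,
      (xi0%:E < pen_quotient f)%E
    & 0 < phi_denominator q J f].

Definition phi_star (q : R) (J : {set 'I_p}) : \bar R :=
  ereal_inf [set (phi_objective q J f)%:E | f in phi_admissible q J].

Definition theoretical_restricted_eigenvalue_condition (kappa0 : R) : Prop :=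
  0 < kappa0 /\ (kappa0%:E <= phi_star 2 finset.setT)%E.

Definition theoretical_compatibility_condition (kappa0 : R) : Prop :=
  0 < kappa0 /\ (kappa0%:E <= phi_star 1 I)%E.

End RestrictedEigenvalue.

(* Main.v *)
(* Mehler's formula expands the covariance of functions of a Gaussian pair with
   correlation [rho] as a sum over [m >= 1] of [rho ^ m] times products of
     Hermite
   coefficients.  Summing over all pairs, the variance of [sum_j g_j (Z_j)] is
   [sum_m a_m^T C^(m) a_m], where [C^(m)] is the [m]-th entrywise power of the
   correlation matrix [C].  Since [C - lambda_min I] is positive semidefinite
     and
   [C] has unit diagonal, Schur's product theorem gives
   [C^(m) >= lambda_min I], whence the variance of the sum is at least
   [lambda_min sum_j Var (g_j (Z_j))].  For trigonometric polynomials the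
   expansion is explicit, from the characteristic function of a Gaussian pair
     and
   the exponential series; they are dense in L^2 of any law on the line, so
   Hermite polynomials and their completeness are not needed. *)

Require Import Defs.
From HB Require Import structures.
From mathcomp Require Import all_boot all_order all_algebra.
From mathcomp Require Import all_classical all_reals all_analysis.
From mathcomp Require Import measurable_realfun ring lra.

Set Implicit Arguments.
Unset Strict Implicit.
Unset Printing Implicit Defensive.

Import Order.TTheory GRing.Theory Num.Theory.
Import numFieldNormedType.Exports.

Local Open Scope classical_set_scope.
Local Open Scope ring_scope.

(** * Quadratic forms and the smallest eigenvalue *)

Section QuadraticForms.
Context {R : realType} {p : nat}.
Implicit Types (A B : 'M[R]_p) (x y : 'rV[R]_p).

(** Laws are known for pairs only, so the variance of the sum is expanded into pairwise covariances
    and no joint law of all the [Z j] is formed; the maps [T j] are absorbed into the functions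
    [f j]. Real cosines with a phase replace complex exponentials. A product of two cosines is half
    the sum of [cos (A - B)] and [cos (A + B)], whose expectations carry [expR (s * t * kappa)] and
    [expR (- (s * t * kappa))] with [kappa] the covariance. Shifting both phases by [k * (pi / 2)]
    reproduces the alternating signs of the second series and makes the term of order [k] a product
    of one coefficient per variable; this factorization is what turns each order into a quadratic
    form. The inequality is proved for partial sums and passed to the limit twice, first in the
    order of the expansion and then in the approximation of the functions, so infinite sums are
    never interchanged. *)

Definition bform A x y : R := \sum_j \sum_k A j k * x 0 j * y 0 k.

Definition sqnorm x : R := \sum_j x 0 j ^+ 2.

Definition psd A : Prop := forall x, 0 <= bform A x x.

Lemma bformE A x y : bform A x y = (x *m A *m y^T) 0 0.
Proof.
rewrite /bform !mxE exchange_big; apply: eq_bigr => k _ /=.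
rewrite !mxE mulr_suml; apply: eq_bigr => j _.
by rewrite (mulrC (A j k)).
Qed.

Lemma bformDl A x y z : bform A (x + y) z = bform A x z + bform A y z.
Proof. by rewrite !bformE !mulmxDl mxE. Qed.

Lemma bformDr A x y z : bform A z (x + y) = bform A z x + bform A z y.
Proof. by rewrite !bformE linearD mulmxDr mxE. Qed.

Lemma bformZl A c x y : bform A (c *: x) y = c * bform A x y.
Proof. by rewrite !bformE -!scalemxAl mxE. Qed.

Lemma bformZr A c x y : bform A x (c *: y) = c * bform A x y.
Proof. by rewrite !bformE linearZ -scalemxAr mxE. Qed.

Lemma bformC A x y : A^T = A -> bform A x y = bform A y x.
Proof.
move=> sA; rewrite [LHS]bformE -[in LHS](trmxK (x *m A *m y^T)) [LHS]mxE.
by rewrite trmx_mul trmxK trmx_mul sA bformE mulmxA.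
Qed.

Lemma sqnorm_ge0 x : 0 <= sqnorm x.
Proof. by apply: sumr_ge0 => j _; exact: sqr_ge0. Qed.

Lemma sqnorm_eq0 x : (sqnorm x == 0) = (x == 0).
Proof.
apply/eqP/eqP => [x0|->]; last first.
  by apply: big1 => j _; rewrite mxE expr0n.
apply/rowP => j; rewrite mxE; apply/eqP; rewrite -sqrf_eq0; apply/eqP.
by have /psumr_eq0P := x0; apply => // k _; exact: sqr_ge0.
Qed.

Lemma sqnormE x : sqnorm x = (x *m x^T) 0 0.
Proof. by rewrite /sqnorm mxE; apply: eq_bigr => j _; rewrite mxE expr2. Qed.

Lemma bformB_scalar A c x :
  bform (A - c%:M) x x = bform A x x - c * sqnorm x.
Proof.
rewrite !bformE mulmxBr mulmxBl mul_mx_scalar -scalemxAl sqnormE.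
by move: (x *m A *m x^T) (x *m x^T) => X Y; rewrite !mxE.
Qed.

(** A crude constant suffices: it makes the set of admissible lower bounds nonempty and supplies the
    finite factor [K] for the inverse matrix. *)
Lemma bform_bound A x :
  `|bform A x x| <= (\sum_j \sum_k `|A j k|) * sqnorm x.
Proof.
have xle j : x 0 j ^+ 2 <= sqnorm x.
  rewrite /sqnorm (bigD1 j)//= lerDl.
  by apply: sumr_ge0 => k _; exact: sqr_ge0.
rewrite (le_trans (ler_norm_sum _ _ _))// mulr_suml ler_sum// => j _.
rewrite (le_trans (ler_norm_sum _ _ _))// mulr_suml ler_sum// => k _.
rewrite -mulrA normrM ler_wpM2l// normrM.
have := xle j; have := xle k.
rewrite -(real_normK (num_real (x 0 j))) -(real_normK (num_real (x 0 k))).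
by have := sqr_ge0 (`|x 0 j| - `|x 0 k|); nra.
Qed.

Lemma psd_CauchySchwarz A x y : A^T = A -> psd A ->
  bform A x y ^+ 2 <= bform A x x * bform A y y.
Proof.
move=> sA pA.
have q t : 0 <= bform A x x + 2 * t * bform A x y + t ^+ 2 * bform A y y.
  have := pA (x + t *: y).
  rewrite !bformDl !bformDr !bformZl !bformZr (bformC y x sA).
  by congr (0 <= _); ring.
have x0 := pA x; have y0 := pA y.
(* [psd] allows isotropic [y], for which the quadratic in [t] is affine: a nonzero slope would give
   it the value -1 at the [t] chosen below. *)
have [y00|yn0] := eqVneq (bform A y y) 0.
  rewrite y00 mulr0; have [->|b0] := eqVneq (bform A x y) 0;
    first by rewrite expr0n.
  have := q (- (bform A x x + 1) / (2 * bform A x y)).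
  rewrite y00 mulr0 addr0 [X in _ + X](_ : _ = - (bform A x x + 1)); first lra.
  by field.
(* This [t] minimizes the quadratic. *)
have := q (- bform A x y / bform A y y).
have yp : 0 < bform A y y by rewrite lt_def yn0.
rewrite [X in 0 <= X -> _](_ :
  _ = (bform A x x * bform A y y - bform A x y ^+ 2) / bform A y y);
  last by field.
by rewrite pmulr_lge0 ?invr_gt0// subr_ge0.
Qed.

(* The best constant [mu] in [mu |x|^2 <= x A x^T] is an eigenvalue: otherwise
   [B := A - mu] is invertible, and Cauchy-Schwarz for the form [B] applied to
   [x] and [x B^-1] gives [|x|^2 <= K x B x^T],
     so that [mu] can be increased. *)
Lemma psd_sub_lambda_min A : (0 < p)%N -> A^T = A ->
  psd (A - (lambda_min A)%:M).
Proof.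
move=> p0 sA.
pose S := [set r : R | forall x, r * sqnorm x <= bform A x x].
pose e : 'rV[R]_p := delta_mx 0 (Ordinal p0).
have e1 : 0 < sqnorm e.
  rewrite lt_def sqnorm_ge0 sqnorm_eq0 andbT.
  by apply/eqP => /rowP/(_ (Ordinal p0)); rewrite !mxE !eqxx => /eqP;
    rewrite oner_eq0.
have S0 : S !=set0.
  exists (- (\sum_j \sum_k `|A j k|)) => x.
  by have := bform_bound A x; rewrite ler_norml mulNr => /andP[].
have Sub : has_ubound S.
  by exists (bform A e e / sqnorm e) => r /(_ e); rewrite ler_pdivlMr.
pose mu := sup S.
have Smu : S mu.
  move=> x; have [->|x0] := eqVneq x 0.
    rewrite (_ : sqnorm 0 = 0); last by apply/eqP; rewrite sqnorm_eq0.
    by rewrite mulr0 bformE !mul0mx mxE.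
  have xp : 0 < sqnorm x by rewrite lt_def sqnorm_ge0 sqnorm_eq0 x0.
  rewrite -ler_pdivlMr//; apply: ge_sup => // r Sr.
  by rewrite ler_pdivlMr.
have pB : psd (A - mu%:M).
  by move=> x; rewrite bformB_scalar subr_ge0.
have sB : (A - mu%:M)^T = A - mu%:M by rewrite linearB /= sA tr_scalar_mx.
have mueig : eigenvalue A mu.
  rewrite /eigenvalue /eigenspace kermx_eq0 row_free_unit.
  apply/negP => uB; set B := A - mu%:M in pB sB uB.
  pose K := \sum_j \sum_k `|invmx B j k| + 1.
  have K0 : 0 < K.
    by rewrite /K ltr_wpDl//; do 2 (apply: sumr_ge0 => ? _).
  suff : S (mu + K^-1).
    by move/(ub_le_sup Sub); rewrite -/mu gerDl leNgt invr_gt0 K0.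
  move=> x; rewrite mulrDl -lerBrDl -bformB_scalar -/B.
  have [->|x0] := eqVneq x 0.
    rewrite (_ : sqnorm 0 = 0); last by apply/eqP; rewrite sqnorm_eq0.
    by rewrite mulr0; exact: pB.
  have xp : 0 < sqnorm x by rewrite lt_def sqnorm_ge0 sqnorm_eq0 x0.
  have := psd_CauchySchwarz x (x *m invmx B) sB pB.
  have -> : bform B x (x *m invmx B) = sqnorm x.
    by rewrite bformE sqnormE trmx_mul trmx_inv sB -mulmxA mulKVmx.
  have -> : bform B (x *m invmx B) (x *m invmx B) = bform (invmx B) x x.
    by rewrite !bformE -[_ *m _ *m B]mulmxA mulVmx// mulmx1 trmx_mul trmx_inv
      sB mulmxA.
  have := pB x => Bx0.
  have : bform (invmx B) x x <= K * sqnorm x.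
    rewrite (le_trans (ler_norm _))// (le_trans (bform_bound _ _))//.
    by rewrite ler_wpM2r ?sqnorm_ge0// lerDl.
  move=> /(ler_wpM2l Bx0) bK /le_trans/(_ bK).
  by rewrite expr2 mulrA ler_pM2r// => h; rewrite mulrC ler_pdivrMr.
move=> x; rewrite bformB_scalar subr_ge0 (le_trans _ (Smu x))//.
(* [ge_inf] asks for a lower bound of the spectrum; [mu] is one, as evaluating the form at an
   eigenvector shows. *)
rewrite ler_wpM2r ?sqnorm_ge0//; apply: ge_inf => //.
exists mu => l /= /eigenvalueP[v vA v0].
have vp : 0 < sqnorm v by rewrite lt_def sqnorm_ge0 sqnorm_eq0 v0.
by have := Smu v; rewrite bformE vA -scalemxAl mxE -sqnormE ler_pM2r.
Qed.

End QuadraticForms.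

(** * Characteristic function of the normal law *)

Section NormalIntegral.
Context {R : realType}.
Local Open Scope ereal_scope.

Local Notation mu := (@lebesgue_measure R).
Local Notation gamma := (@normal_prob R 0 1).
Local Notation g := (@normal_pdf R 0 1).

(** Both functions integrate over every measurable set to its normal measure. This opens the
    change-of-variables formula to the explicit density. *)
Lemma ae_eq_normal_RN : ae_eq mu [set: R]
  (Radon_Nikodym_SigmaFinite.f gamma mu) (fun x => (g x)%:E).
Proof.
apply: integral_ae_eq => //.
- by apply: Radon_Nikodym_SigmaFinite.f_integrable;
  exact: normal_prob_dominates.
- by apply/measurable_EFinP; exact: measurable_normal_pdf.
- move=> A _ mA.
  by rewrite -Radon_Nikodym_SigmaFinite.f_integral//;
    exact: normal_prob_dominates.
Qed.

Lemma ge0_integral_normal (f : R -> \bar R) :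
  measurable_fun setT f -> (forall x, 0 <= f x) ->
  \int[gamma]_x f x = \int[mu]_x (f x * (g x)%:E).
Proof.
move=> mf f0.
rewrite -(Radon_Nikodym_SigmaFinite.change_of_variables (normal_prob_dominates
  0 1))//.
apply: ae_eq_integral => //.
- apply: emeasurable_funM => //; apply: measurable_int.
  by apply: Radon_Nikodym_SigmaFinite.f_integrable;
    exact: normal_prob_dominates.
- apply: emeasurable_funM => //.
  by apply/measurable_EFinP; exact: measurable_normal_pdf.
- by move: ae_eq_normal_RN; apply: filterS => x /= h _; rewrite h.
Qed.

Lemma integral_normal (f : R -> \bar R) : gamma.-integrable setT f ->
  \int[gamma]_x f x = \int[mu]_x (f x * (g x)%:E).
Proof.
move=> fi; have mf := measurable_int _ fi.
have /integrableP[_ foo] := fi.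
rewrite ge0_integral_normal// in foo; last exact: measurableT_comp.
have fgi : mu.-integrable setT (fun x => f x * (g x)%:E).
  apply/integrableP; split.
    apply: emeasurable_funM => //.
    by apply/measurable_EFinP; exact: measurable_normal_pdf.
  by under eq_integral do rewrite abseM abse_EFin ger0_norm ?normal_pdf_ge0//.
rewrite integralE [RHS]integralE !ge0_integral_normal.
- by congr (_ - _); apply: eq_integral => x _;
    rewrite ?(funeposE, funenegE) ?maxe_pMl ?lee_fin ?normal_pdf_ge0//
      ?mul0e// ?mulNe.
- exact: measurable_funeneg.
- by [].
- exact: measurable_funepos.
- by [].
Qed.

End NormalIntegral.

(** * Stein's identity for the standard normal law *)

Section CharacteristicFunction.
Context {R : realType}.

Local Notation mu := (@lebesgue_measure R).
Local Notation gamma := (@normal_prob R 0 1).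
Local Notation g := (@normal_pdf R 0 1).

(** Dominated convergence for the truncations to [[-n, n]], whose integrals are differences of
    boundary values of [F]; limits of [F] are therefore needed along integers only. *)
Lemma integral_derivative_eq0 (F f : R -> R) :
  continuous f -> (forall x : R, is_derive x (1 : R) F (f x)) ->
  mu.-integrable setT (EFin \o f) ->
  F n%:R @[n --> \oo] --> 0 -> F (- n%:R) @[n --> \oo] --> 0 ->
  (\int[mu]_x (f x)%:E = 0)%E.
Proof.
move=> cf dF fi F1 F2.
have cF : continuous F.
  by move=> x; apply: differentiable_continuous; apply/derivable1_diffP;
    case: (dF x).
pose fn n x := (EFin \o f \_ `[- n%:R, n%:R]%classic) x.
have : (\int[mu]_x (fn n x))%E @[n --> \oo] --> (\int[mu]_x (f x)%:E)%E.
  apply: (@dominated_cvg _ _ _ mu setT _ fn (EFin \o f) (abse \o (EFin \o f)))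
    => //.
  - move=> n; apply/measurable_EFinP; apply/(measurable_restrictT _ _).1 => //.
    by apply: measurable_funTS; move/integrableP : fi => [/measurable_EFinP].
  - move=> x _; apply: cvg_near_cst; near=> n.
    rewrite /fn /= patchE ifT// inE /= in_itv /= -ler_norml.
    by near: n; exact: nbhs_infty_ger.
  - exact: integrable_abse.
  - move=> n x _; rewrite /fn /= patchE; case: ifPn => // _.
    by rewrite normr0 lee_fin.
have : (\int[mu]_x (fn n x))%E @[n --> \oo] --> 0%E.
  have h : (F n%:R - F (- n%:R))%:E @[n --> \oo] --> (0 : R)%:E.
    apply/fine_cvgP; split; first exact: nearW.
    by rewrite -(subrr 0); exact: cvgB.
  apply: cvg_trans h.
  apply: near_eq_cvg; near=> n.
  have n0 : (- n%:R < n%:R :> R).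
    by rewrite gtrN// ltr0n; near: n; exists 1%N.
  rewrite /= EFinB -(@continuous_FTC2 _ f F (- n%:R) n%:R n0).
  - rewrite [LHS]integral_mkcond; apply: eq_integral => x _.
    by rewrite /fn /= restrict_EFin.
  - exact: continuous_subspaceT.
  - split; first by move=> x _; case: (dF x).
    + by apply: cvg_at_right_filter; exact: cF.
    + by apply: cvg_at_left_filter; exact: cF.
  - by move=> x _; rewrite derive1E; case: (dF x).
by move=> h1 h2; apply: (cvg_unique _ h2 h1).
Unshelve. all: by end_near. Qed.

Lemma normal_pdf01E x : g x = normal_peak 1 * expR (- (x ^+ 2 / 2)).
Proof.
by rewrite /normal_pdf oner_eq0 /normal_fun subr0 expr1n mulNr.
Qed.

Lemma is_derive_normal_pdf01 (x : R) : is_derive x (1 : R) g (- x * g x).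
Proof.
rewrite (_ : normal_pdf 0 1 =
    normal_peak 1 \*: (expR \o ((- 2^-1) \*: (@id R ^+ 2)))).
  apply: trigger_derive.
  rewrite /GRing.scale /= expr1 mulr1.
  set e := expR _; rewrite -[_ *: e]/(normal_peak 1 * e).
  by field.
apply/funext => y; rewrite normal_pdf01E /= /GRing.scale /=.
by congr (_ * expR _); rewrite fctE /=; field.
Qed.

(** Quadratic growth is absorbed by half of the Gaussian exponent, which leaves a multiple of the
    density of variance 2. The 4 comes from [1 + x^2 <= 4 (1 + x^2 / 4) <= 4 exp (x^2 / 4)]. *)
Lemma normal_pdf01_le :
  exists2 C : R, 0 <= C & forall x :
    R, (1 + x ^+ 2) * g x <= C * normal_pdf 0 (Num.sqrt 2) x.
Proof.
have s2 : Num.sqrt 2 != 0 :> R by rewrite gt_eqF// sqrtr_gt0.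
have p1 : 0 < normal_peak (1 : R) by exact: normal_peak_gt0.
have p2 := normal_peak_gt0 s2.
exists (4 * normal_peak 1 / normal_peak (Num.sqrt 2)).
  by rewrite !mulr_ge0 ?invr_ge0// ltW.
move=> y; rewrite normal_pdf01E /normal_pdf (negbTE s2) /normal_fun subr0.
rewrite [leRHS]mulrA divfK ?gt_eqF// mulrCA -[leRHS]mulrA [leRHS]mulrCA
  ler_pM2l//.
rewrite (_ : - y ^+ 2 / _ = - (y ^+ 2 / 4)); last first.
  by rewrite sqr_sqrtr// -mulr_natl; field.
rewrite (_ : - (y ^+ 2 / 2) = - (y ^+ 2 / 4) + - (y ^+ 2 / 4)); last by field.
rewrite expRD mulrA ler_pM2r ?expR_gt0// expRN ler_pdivrMr ?expR_gt0//.
have := expR_ge1Dx (y ^+ 2 / 4); have := sqr_ge0 y; lra.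
Qed.

Lemma integrable_sqr_normal_pdf01 :
  mu.-integrable setT (fun x => ((1 + x ^+ 2) * g x)%:E).
Proof.
have [C C0 gC] := normal_pdf01_le.
apply: (@le_integrable _ _ _ mu setT measurableT _
  (fun x => (C%:E * (normal_pdf 0 (Num.sqrt 2) x)%:E)%E)).
- apply/measurable_EFinP; apply: measurable_funM.
    by apply: measurable_funD => //; exact: measurable_funX.
  exact: measurable_normal_pdf.
- move=> x _; rewrite -EFinM !abse_EFin lee_fin !ger0_norm//.
  + by rewrite mulr_ge0// normal_pdf_ge0.
  + by rewrite mulr_ge0 ?normal_pdf_ge0// addr_ge0 ?sqr_ge0.
- by apply: integrableZl => //; exact: integrable_normal_pdf.
Qed.

Lemma integrable_bounded_normal (C : R) (h : R -> R) : measurable_fun setT h ->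
  (forall x, `|h x| <= C * (1 + x ^+ 2)) ->
  mu.-integrable setT (fun x => (h x * g x)%:E).
Proof.
move=> mh hC; apply: (@le_integrable _ _ _ mu setT measurableT _
  (fun x => (C%:E * ((1 + x ^+ 2) * g x)%:E)%E)).
- apply/measurable_EFinP; apply: measurable_funM => //.
  exact: measurable_normal_pdf.
- move=> x _; rewrite -EFinM !abse_EFin lee_fin mulrA !(normrM _ (g x)).
  rewrite ler_wpM2r//; apply: le_trans (hC x) _; exact: ler_norm.
- by apply: integrableZl => //; exact: integrable_sqr_normal_pdf01.
Qed.

Lemma integrable_normal_bounded (C : R) (h : R -> R) : measurable_fun setT h ->
  (forall x, `|h x| <= C * (1 + x ^+ 2)) ->
  gamma.-integrable setT (EFin \o h).
Proof.
move=> mh hC; apply/integrableP; split; first exact/measurable_EFinP.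
rewrite ge0_integral_normal//; last first.
  by apply: measurableT_comp => //; exact/measurable_EFinP.
have /integrableP[_] := integrable_bounded_normal mh hC.
congr (_ < _)%E; apply: eq_integral => x _.
by rewrite EFinM abseM [(`|(g _)%:E|)%E]gee0_abs ?lee_fin ?normal_pdf_ge0.
Qed.

(** Only the square of [u n] is prescribed: the density is even, so the endpoints [n] and [-n] are
    handled together. The 4 in [K] comes from [(1 + n)^2 <= 4 (1 + n^2 / 2)]. *)
Lemma cvg_normal_boundary (C : R) (h : R -> R) (u : nat -> R) :
  (forall n, u n ^+ 2 = n%:R ^+ 2) ->
  (forall x, `|h x| <= C * (1 + `|x|)) -> h (u n) * g (u n) @[n --> \oo] --> 0.
Proof.
move=> un hC; set K := C * normal_peak 1 * 4.
apply: norm_cvg0.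
apply: (@squeeze_cvgr nat \oo _ R (fun=> 0) (fun n => K * n.+1%:R^-1)
  (fun n => `|h (u n) * g (u n)|)).
- near=> n; rewrite normr_ge0/= normrM.
  have C0 : 0 <= C by have := hC 0; rewrite normr0 addr0 mulr1; apply: le_trans.
  have p1 : 0 < normal_peak (1 : R) by exact: normal_peak_gt0.
  have -> : `|g (u n)| = normal_peak 1 * expR (- (n%:R ^+ 2 / 2)).
    by rewrite ger0_norm ?normal_pdf_ge0// normal_pdf01E un.
  have un' : `|u n| = n%:R by rewrite -[LHS]sqrtr_sqr ?un sqrtr_sqr ger0_norm.
  apply: le_trans (ler_wpM2r _ (hC (u n))) _.
    by rewrite mulr_ge0 ?expR_ge0// ltW.
  rewrite un' /K expRN.
  rewrite [leLHS](_ : _ = C * normal_peak 1 * ((1 + n%:R) / expR (n%:R ^+ 2 /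
    2))); last by field.
  rewrite -[leRHS]mulrA ler_wpM2l//; first by rewrite mulr_ge0// ltW.
  rewrite ler_pdivrMr ?expR_gt0// mulrAC ler_pdivlMr ?ltr0n// -natr1.
  have := expR_ge1Dx (n%:R ^+ 2 / 2 : R); have := sqr_ge0 (n%:R - 1 : R); nra.
- exact: cvg_cst.
- rewrite -(mulr0 K); apply: cvgM; first exact: cvg_cst.
  exact: cvg_harmonic.
Unshelve. all: by end_near. Qed.

(** The difference of the two integrands is the derivative of [h * g], because [g' = - x g], and
    [h * g] vanishes at both ends. *)
Lemma stein (h h' : R -> R) (C : R) : continuous h' ->
  (forall x : R, is_derive x (1 : R) h (h' x)) ->
  (forall x, `|h x| <= C * (1 + `|x|)) -> (forall x, `|h' x| <= C) ->
  \int[mu]_x (h' x * g x) = \int[mu]_x (x * h x * g x).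
Proof.
move=> ch' dh hC h'C.
have ch : continuous h.
  by move=> x; apply: differentiable_continuous; apply/derivable1_diffP;
    case: (dh x).
have C0 : 0 <= C by apply: le_trans (h'C 0).
have i1 : mu.-integrable setT (fun x => (h' x * g x)%:E).
  apply: (@integrable_bounded_normal C); first exact: continuous_measurable_fun.
  by move=> x; rewrite (le_trans (h'C x))// ler_peMr// lerDl sqr_ge0.
have i2 : mu.-integrable setT (fun x => (x * h x * g x)%:E).
  apply: (@integrable_bounded_normal (2 * C)).
    by apply: measurable_funM => //; exact: continuous_measurable_fun.
  move=> x; rewrite normrM (le_trans (ler_wpM2l _ (hC x)))//.
  rewrite mulrCA (mulrC 2) -mulrA ler_wpM2l//.
  rewrite -[in leRHS](real_normK (num_real x)).
  by have := normr_ge0 x; have := sqr_ge0 (`|x| - 1); nra.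
apply/eqP; rewrite -subr_eq0 -RintegralB//; apply/eqP.
suff h0 : (\int[mu]_x (h' x * g x - x * h x * g x)%:E = 0)%E.
  by rewrite /Rintegral h0.
apply: (@integral_derivative_eq0 (h \* g)).
- have cg : continuous g by apply: continuous_normal_pdf; exact: oner_neq0.
  move=> x; apply: cvgB; apply: cvgM; [exact: ch'|exact: cg| |exact: cg].
  by apply: cvgM; [exact: cvg_id|exact: ch].
- move=> x; have dg := is_derive_normal_pdf01 x; apply: trigger_derive.
  by rewrite /GRing.scale /=; ring.
- exact: (integrableB measurableT i1 i2).
- by apply: (@cvg_normal_boundary C).
- by apply: (@cvg_normal_boundary C) => // n; rewrite sqrrN.
Qed.

End CharacteristicFunction.

(** * Characteristic function and first two moments *)

Section CharacteristicFunctionNormal.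
Context {R : realType}.

Local Notation mu := (@lebesgue_measure R).
Local Notation gamma := (@normal_prob R 0 1).
Local Notation g := (@normal_pdf R 0 1).

Lemma Rintegral_normal (C : R) (h : R -> R) : measurable_fun setT h ->
  (forall x, `|h x| <= C * (1 + x ^+ 2)) ->
  \int[gamma]_x h x = \int[mu]_x (h x * g x).
Proof.
by move=> mh hC; rewrite /Rintegral integral_normal//;
  exact: integrable_normal_bounded hC.
Qed.

Lemma continuous_cosaff (t c : R) : continuous (fun x : R => cos (t * x + c)).
Proof.
move=> x; apply: (@continuous_comp _ _ _ (fun x => t * x + c) (@cos R));
  last exact: continuous_cos.
by apply: cvgD; [apply: cvgM; [exact: cvg_cst|exact: cvg_id]|exact: cvg_cst].
Qed.

Lemma is_derive_cosaff (t c x : R) :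
  is_derive x (1 : R) (fun x => cos (t * x + c)) (- t * sin (t * x + c)).
Proof.
rewrite (_ : (fun x => _) = cos \o (t \*: (@id R) + cst c)) //.
apply: trigger_derive; rewrite /GRing.scale /= addr0 mulr1 mulrC mulNr.
by rewrite mulrN.
Qed.

Lemma is_derive_sinaff (t c x : R) :
  is_derive x (1 : R) (fun x => sin (t * x + c)) (t * cos (t * x + c)).
Proof.
rewrite (_ : (fun x => _) = sin \o (t \*: (@id R) + cst c)) //.
by apply: trigger_derive; rewrite /GRing.scale /= addr0 mulr1 mulrC.
Qed.

Lemma measurable_cosaff (t c : R) : measurable_fun setT (fun x :
  R => cos (t * x + c)).
Proof. exact: continuous_measurable_fun (@continuous_cosaff t c). Qed.

Lemma measurable_sinaff (t c : R) : measurable_fun setT (fun x :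
  R => sin (t * x + c)).
Proof.
apply: continuous_measurable_fun => x; apply: differentiable_continuous.
by apply/derivable1_diffP; case: (is_derive_sinaff t c x).
Qed.

Lemma normr_cos_le1 (x : R) : `|cos x| <= 1.
Proof. by rewrite ler_norml cos_geN1 cos_le1. Qed.

Lemma normr_sin_le1 (x : R) : `|sin x| <= 1.
Proof. by rewrite ler_norml sin_geN1 sin_le1. Qed.

Lemma integral_xsinaff (t c : R) :
  \int[mu]_x (x * sin (t * x + c) * g x) =
    t * \int[mu]_x (cos (t * x + c) * g x).
Proof.
rewrite -RintegralZl//; last first.
  apply: (@integrable_bounded_normal _ 1); first exact: measurable_cosaff.
  by move=> x; rewrite mul1r (le_trans (normr_cos_le1 _))// lerDl sqr_ge0.
rewrite -(@stein _ _ _ (1 + `|t|) _ (is_derive_sinaff t c)).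
- by apply: eq_Rintegral => x _; rewrite mulrA.
- by move=> x; apply: cvgM; [exact: cvg_cst|exact: continuous_cosaff].
- move=> x; rewrite (le_trans (normr_sin_le1 _))//.
  by have := normr_ge0 t; have := normr_ge0 x; nra.
- move=> x; rewrite normrM (le_trans (ler_wpM2l _ (normr_cos_le1 _)))//.
  by rewrite mulr1 lerDr.
Qed.

(** Differentiation under the integral gives [- x sin (t x + c)], and Stein's identity for the sine
    turns its integral into [- t] times the original one: a linear differential equation in [t]. The
    domination rests on [|x| <= 1 + x^2]. *)
Lemma is_derive_charfun (c t : R) :
  is_derive t (1 : R) (fun t => \int[mu]_x (cos (t * x + c) * g x))
    (- t * \int[mu]_x (cos (t * x + c) * g x)).
Proof.
pose f (t x : R) := cos (t * x + c) * g x.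
have df s x : is_derive s (1 : R) (f ^~ x) (- x * sin (s * x + c) * g x).
  have := is_derive_cosaff x c s; under eq_fun do rewrite mulrC.
  move=> h; have -> : f^~ x = (fun s => cos (s * x + c)) * cst (g x) by [].
  apply: trigger_derive; rewrite /GRing.scale /= mulr0 add0r mulrC.
  by rewrite (mulrC x s).
have d1f s x : partial1of2 f s x = - x * sin (s * x + c) * g x.
  by rewrite partial1of2E; case: (df s x).
have intf s : `]t - 1, t + 1[%classic s -> mu.-integrable setT (EFin \o f s).
  move=> _; apply: (@integrable_bounded_normal _ 1);
    first exact: measurable_cosaff.
  by move=> x; rewrite mul1r (le_trans (normr_cos_le1 _))// lerDl sqr_ge0.
have It : `]t - 1, t + 1[%classic t by rewrite /= in_itv /= ltrDl ltrBlDr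
  ltrDl ltr01.
have derf s x : `]t - 1, t + 1[%classic s -> setT x -> derivable (f ^~ x) s 1.
  by move=> _ _; case: (df s x).
pose G (x : R) := (1 + x ^+ 2) * g x.
have G0 x : 0 <= G x by rewrite mulr_ge0 ?normal_pdf_ge0// addr_ge0// sqr_ge0.
have G_ub s x : `]t - 1, t + 1[%classic s -> setT x -> `|partial1of2 f s x| <=
  G x.
  move=> _ _; rewrite d1f !normrM normrN (ger0_norm (normal_pdf_ge0 _ _ _)).
  rewrite ler_wpM2r ?normal_pdf_ge0// (le_trans (ler_wpM2l _ (normr_sin_le1
    _)))//.
  rewrite mulr1 -(real_normK (num_real x)).
  by have := normr_ge0 x; have := sqr_ge0 (`|x| - 1); nra.
have iG : mu.-integrable setT (EFin \o G) by exact: integrable_sqr_normal_pdf01.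
apply: DeriveDef.
  exact: (derivable_under_integral measurableT It intf derf G0 iG G_ub).
rewrite -derive1E (differentiation_under_integral measurableT It intf derf G0
  iG G_ub).
rewrite mulNr -integral_xsinaff -mulN1r -RintegralZl//.
  by apply: eq_Rintegral => x _; rewrite d1f; ring.
apply: (@integrable_bounded_normal _ 1).
  by apply: measurable_funM => //; exact: measurable_sinaff.
move=> x; rewrite normrM (le_trans (ler_wpM2l _ (normr_sin_le1 _)))// mulr1
  mul1r.
rewrite -(real_normK (num_real x)).
by have := normr_ge0 x; have := sqr_ge0 (`|x| - 1); nra.
Qed.

Lemma Rintegral_normal_pdf01 : \int[mu]_x g x = 1.
Proof. by rewrite /Rintegral integral_normal_pdf. Qed.

(** The phase [c] covers real and imaginary parts at once. The product of the integral with
    [exp (t^2 / 2)] has zero derivative, so it keeps its value [cos c] at [t = 0]. *)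
Lemma charfun_normal (t c : R) :
  \int[gamma]_x cos (t * x + c) = cos c * expR (- (t ^+ 2 / 2)).
Proof.
rewrite (@Rintegral_normal 1); last 2 first.
- exact: measurable_cosaff.
- by move=> x; rewrite mul1r (le_trans (normr_cos_le1 _))// lerDl sqr_ge0.
pose phi t := \int[mu]_x (cos (t * x + c) * g x).
pose psi := phi * (expR \o (2^-1 \*: (@id R ^+ 2))).
have dpsi s : is_derive s (1 : R) psi 0.
  have dphi : is_derive s (1 : R) phi (- s * phi s) := is_derive_charfun c s.
  apply: trigger_derive; rewrite /GRing.scale /= expr1 mulr1.
  by set e := expR _; field.
have := is_derive_0_is_cst t 0 dpsi.
rewrite /psi /phi !fctE /= -![_ *: _]/(_ * _) expr0n mulr0 expR0 mulr1.
have -> : \int[mu]_x (cos (0 * x + c) * g x) = cos c.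
  under eq_Rintegral do rewrite mul0r add0r.
  rewrite RintegralZl//; last exact: integrable_normal_pdf.
  by rewrite Rintegral_normal_pdf01 mulr1.
by move=> <-; rewrite -mulrA -expRD mulrC (mulrC _ 2^-1) subrr expR0 mul1r.
Qed.

Lemma Rintegral_normal_id : \int[gamma]_x x = 0.
Proof.
rewrite (@Rintegral_normal 1); last 2 first.
- exact: measurable_id.
- move=> x; rewrite mul1r -(real_normK (num_real x)).
  by have := normr_ge0 x; have := sqr_ge0 (`|x| - 1); nra.
transitivity (\int[mu]_x (x * cst 1 x * g x)).
  by apply: eq_Rintegral => x _; rewrite mulr1.
rewrite -(@stein _ (cst 1) (cst 0) 1 _ (fun x => is_derive_cst (1 : R) x 1)).
- under eq_Rintegral do rewrite mul0r.
  by rewrite Rintegral_cst// mul0r.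
- by move=> x; exact: cvg_cst.
- by move=> x; rewrite normr1 mul1r lerDl.
- by move=> x; rewrite normr0.
Qed.

Lemma Rintegral_normal_sqr : \int[gamma]_x (x ^+ 2) = 1.
Proof.
rewrite (@Rintegral_normal 1); last 2 first.
- by apply: measurable_funX; exact: measurable_id.
- by move=> x; rewrite mul1r ger0_norm ?sqr_ge0// lerDr.
transitivity (\int[mu]_x (x * x * g x)).
  by apply: eq_Rintegral => x _; rewrite expr2.
rewrite -(@stein _ id (cst 1) 1 _ (fun x => is_derive_id x 1)).
- rewrite -[RHS]Rintegral_normal_pdf01; apply: eq_Rintegral => x _.
  by rewrite /= mul1r.
- by move=> x; exact: cvg_cst.
- by move=> x; rewrite mul1r lerDr.
- by move=> x; rewrite normr1.
Qed.

End CharacteristicFunctionNormal.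

(** * Gaussian pairs *)

Section SquareIntegrable.
Context {d : measure_display} {T : measurableType d} {R : realType}.
Variable P : probability T R.
Implicit Types X Y : T -> R.

Lemma Lfun2_of_sqr X : measurable_fun setT X ->
  P.-integrable setT (fun x => (X x ^+ 2)%:E) -> X \in Lfun P 2%:E.
Proof.
move=> mX iX; rewrite inE; apply/andP; split; rewrite inE//=.
rewrite /finite_norm unlock /Lnorm /= poweR_lty//.
have /integrableP[_] := iX; congr (_ < _)%E; apply: eq_integral => x _.
rewrite /= powR_mulrn// normrX//.
Qed.

Lemma Lfun2_integrable X : X \in Lfun P 2%:E -> P.-integrable setT (EFin \o X).
Proof.
move=> X2; apply/Lfun1_integrable; apply: Lfun_subset12 X2.
exact: fin_num_measure.
Qed.

Lemma Lfun2_integrableM X Y : X \in Lfun P 2%:E -> Y \in Lfun P 2%:E ->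
  P.-integrable setT (fun x => (X x * Y x)%:E).
Proof. by move=> X2 Y2; apply/Lfun1_integrable; exact: Lfun2_mul_Lfun1. Qed.

Lemma fine_covarianceE X Y : X \in Lfun P 2%:E -> Y \in Lfun P 2%:E ->
  fine (covariance P X Y) =
  \int[P]_w (X w * Y w) - (\int[P]_w X w) * (\int[P]_w Y w).
Proof.
move=> X2 Y2.
have X1 := Lfun2_integrable X2; have Y1 := Lfun2_integrable Y2.
have XY := Lfun2_integrableM X2 Y2.
rewrite covarianceE; [|exact/Lfun1_integrable..].
rewrite !unlock fineB ?fin_numM ?integrable_fin_num// fineM
  ?integrable_fin_num//.
Qed.

(** A variable of zero variance is almost surely its mean [c], so [f \o X] is almost surely [f c].
    It serves by contraposition: positive variance of the transformed variable excludes a degenerate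
    Gaussian. *)
Lemma variance_comp_eq0 X (f : R -> R) : X \in Lfun P 2%:E ->
  measurable_fun setT X -> measurable_fun setT f ->
  fine 'V_P[X] = 0 -> ('V_P[f \o X] = 0)%E.
Proof.
move=> X2 mX mf V0.
have VX0 : 'V_P[X]%E = 0%E by rewrite -(fineK (variance_fin_num X2)) V0.
set c := fine 'E_P[X].
have : ae_eq P setT (fun w => ((X w - c) * (X w - c))%:E) (cst 0%E).
  apply/ae_eq_integral_abs => //.
    by apply/measurable_EFinP; apply: measurable_funM; exact: measurable_funB.
  rewrite -[RHS]VX0 /variance unlock [in RHS]unlock; apply: eq_integral => w _.
  have : (0 <= ((X w - c) * (X w - c))%:E)%E by rewrite lee_fin -expr2 sqr_ge0.
  by move/gee0_abs => ->; rewrite /c unlock.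
have mfX : measurable_fun setT (f \o X) by exact: measurableT_comp.
move=> aeX.
have aefX : {ae P, forall w, f (X w) = f c}.
  move: aeX; apply: filterS => w /= /(_ I) [] /eqP.
  by rewrite mulf_eq0 orbb subr_eq0 => /eqP ->.
have EfX : fine (\int[P]_w ((f \o X) w)%:E)%E = f c.
  rewrite (ae_eq_integral (cst (f c)%:E))//.
  - by rewrite integral_cst//= probability_setT mule1.
  - exact/measurable_EFinP.
  - by move: aefX; apply: filterS => w /= ->.
rewrite /variance covariance.unlock expectation.unlock EfX.
rewrite (ae_eq_integral (cst 0%E)) ?integral0//.
- apply/measurable_EFinP; apply: measurable_funM => /=;
  apply: measurable_funB => //.
- by move: aefX; apply: filterS => w /= + _; rewrite fctE /= => ->;
  rewrite subrr mul0r.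
Qed.

Lemma bounded_integrable X (C : R) : measurable_fun setT X ->
  (forall w, `|X w| <= C) -> P.-integrable setT (EFin \o X).
Proof.
move=> mX XC; apply: measurable_bounded_integrable => //.
  by rewrite (le_lt_trans (probability_le1 P measurableT))// ltry.
exists C; split; first exact: num_real.
by move=> M CM x _ /=; apply: le_trans (XC x) _; exact: ltW.
Qed.

End SquareIntegrable.

(** * Integrals under a pair of independent standard normals *)

Section ProductIntegral.
Context {R : realType}.

Local Notation gamma := (@normal_prob R 0 1).
Local Notation Gamma := (gamma \x gamma)%E.

Lemma integrable_prodM (f h : R -> R) :
  gamma.-integrable setT (EFin \o f) -> gamma.-integrable setT (EFin \o h) ->
  Gamma.-integrable setT (fun u => (f u.1 * h u.2)%:E).
Proof.
move=> fi hi.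
have mf : measurable_fun setT f by move/integrableP : fi => [/measurable_EFinP].
have mh : measurable_fun setT h by move/integrableP : hi => [/measurable_EFinP].
apply/integrable12ltyP => /=.
  by apply/measurable_EFinP; apply: measurable_funM; apply: measurableT_comp.
have -> : (\int[gamma]_x \int[gamma]_y (`|f x * h y|)%:E =
    \int[gamma]_x (`|(f x)%:E| * \int[gamma]_y `|(h y)%:E|))%E.
  apply: eq_integral => x _; rewrite -ge0_integralZl//.
    by apply: eq_integral => y _; rewrite normrM EFinM.
  by apply: measurableT_comp => //; exact/measurable_EFinP.
rewrite ge0_integralZr//; last 2 first.
- by apply: measurableT_comp => //; exact/measurable_EFinP.
- exact: integral_ge0.
have /integrableP[_ f1] := fi; have /integrableP[_ h1] := hi.
by rewrite lte_mul_pinfty// ?integral_ge0// ge0_fin_numE// integral_ge0.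
Qed.

Lemma Rintegral_prodM (f h : R -> R) :
  gamma.-integrable setT (EFin \o f) -> gamma.-integrable setT (EFin \o h) ->
  \int[Gamma]_u (f u.1 * h u.2) = (\int[gamma]_x f x) * (\int[gamma]_x h x).
Proof.
move=> fi hi; have fhi := integrable_prodM fi hi.
rewrite /Rintegral -(integral12_prod_meas1 fhi) /fubini_F /=.
have -> : (\int[gamma]_x \int[gamma]_y (f x * h y)%:E =
    \int[gamma]_x ((f x)%:E * \int[gamma]_y (h y)%:E))%E.
  apply: eq_integral => x _; rewrite -integralZl//.
rewrite -(fineK (integrable_fin_num measurableT hi)) integralZr//.
by rewrite fineM// integrable_fin_num.
Qed.

End ProductIntegral.

Section GaussianMoments.
Context {R : realType}.

Local Notation gamma := (@normal_prob R 0 1).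
Local Notation Gamma := (gamma \x gamma)%E.

Lemma integrable_normal_id : gamma.-integrable setT (fun x => x%:E).
Proof.
apply: (@integrable_normal_bounded _ 1); first exact: measurable_id.
move=> x; rewrite mul1r -(real_normK (num_real x)).
by have := normr_ge0 x; have := sqr_ge0 (`|x| - 1); nra.
Qed.

Lemma integrable_normal_sqr : gamma.-integrable setT (fun x => (x ^+ 2)%:E).
Proof.
apply: (@integrable_normal_bounded _ 1).
  by apply: measurable_funX; exact: measurable_id.
by move=> x; rewrite mul1r ger0_norm ?sqr_ge0// lerDr.
Qed.

Lemma integrable_normal_cst1 : gamma.-integrable setT (fun x => (1 : R)%:E).
Proof.
apply: (@integrable_normal_bounded _ 1); first exact: measurable_cst.
by move=> x; rewrite mul1r normr1 lerDl sqr_ge0.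
Qed.

Lemma Rintegral_normal_cst1 : \int[gamma]_x (1 : R) = 1.
Proof.
rewrite Rintegral_cst// mul1r -[RHS]/(fine 1%:E); congr fine.
exact: probability_setT.
Qed.

Lemma Gamma_linear (a b : R) :
  Gamma.-integrable setT (EFin \o (fun u => a * u.1 + b * u.2)) /\
  \int[Gamma]_u (a * u.1 + b * u.2) = 0.
Proof.
have i1 := integrable_prodM integrable_normal_id integrable_normal_cst1.
have i2 := integrable_prodM integrable_normal_cst1 integrable_normal_id.
have j1 := integrableZl measurableT a i1.
have j2 := integrableZl measurableT b i2.
have e : (fun u : R * R => a * u.1 + b * u.2) =
    (fun u => a * (u.1 * 1) + b * (1 * u.2)).
  by apply/funext => u; rewrite mulr1 mul1r.
rewrite e; split; first exact: (integrableD measurableT j1 j2).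
rewrite RintegralD// [X in X + _]RintegralZl// [X in _ + X]RintegralZl//.
have -> : \int[Gamma]_u (u.1 * 1) = _ :=
  Rintegral_prodM integrable_normal_id integrable_normal_cst1.
have -> : \int[Gamma]_u (1 * u.2) = _ :=
  Rintegral_prodM integrable_normal_cst1 integrable_normal_id.
by rewrite Rintegral_normal_id mulr0 mul0r !mulr0 addr0.
Qed.

Lemma Gamma_quadratic (a b c e : R) :
  Gamma.-integrable setT
    (EFin \o (fun u => (a * u.1 + b * u.2) * (c * u.1 + e * u.2))) /\
  \int[Gamma]_u ((a * u.1 + b * u.2) * (c * u.1 + e * u.2)) = a * c + b * e.
Proof.
have i1 := integrable_prodM integrable_normal_sqr integrable_normal_cst1.
have i2 := integrable_prodM integrable_normal_id integrable_normal_id.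
have i3 := integrable_prodM integrable_normal_cst1 integrable_normal_sqr.
have j1 := integrableZl measurableT (a * c) i1.
have j2 := integrableZl measurableT (a * e + b * c) i2.
have j3 := integrableZl measurableT (b * e) i3.
have j12 := integrableD measurableT j1 j2.
have E : (fun u : R * R => (a * u.1 + b * u.2) * (c * u.1 + e * u.2)) =
    (fun u => (a * c) * (u.1 ^+ 2 * 1) + (a * e + b * c) * (u.1 * u.2) +
      (b * e) * (1 * u.2 ^+ 2)).
  by apply/funext => u; ring.
rewrite E; split; first exact: (integrableD measurableT j12 j3).
rewrite RintegralD// RintegralD//.
rewrite [X in X + _ + _]RintegralZl// [X in _ + X + _]RintegralZl// [X in _ +
  X]RintegralZl//.
have -> : \int[Gamma]_u (u.1 ^+ 2 * 1) = _ :=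
  Rintegral_prodM integrable_normal_sqr integrable_normal_cst1.
have -> : \int[Gamma]_u (u.1 * u.2) = _ :=
  Rintegral_prodM integrable_normal_id integrable_normal_id.
have -> : \int[Gamma]_u (1 * u.2 ^+ 2) = _ :=
  Rintegral_prodM integrable_normal_cst1 integrable_normal_sqr.
rewrite Rintegral_normal_id Rintegral_normal_sqr Rintegral_normal_cst1.
by rewrite !mulr1 !mulr0 addr0.
Qed.

(** The addition formula separates the variables, with sines written as cosines shifted by [pi / 2]
    so that [charfun_normal] covers every factor. The product of the two shifted factors integrates
    to 0 because [cos (pi / 2) = 0]. *)
Lemma Gamma_cos (a b c : R) :
  Gamma.-integrable setT (EFin \o (fun u => cos (a * u.1 + b * u.2 + c))) /\
  \int[Gamma]_u cos (a * u.1 + b * u.2 + c) =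
    cos c * expR (- ((a ^+ 2 + b ^+ 2) / 2)).
Proof.
have ic t s : gamma.-integrable setT (fun x => (cos (t * x + s))%:E).
  apply: (@integrable_normal_bounded _ 1); first exact: measurable_cosaff.
  by move=> x; rewrite mul1r (le_trans (normr_cos_le1 _))// lerDl sqr_ge0.
have i1 := integrable_prodM (ic a 0) (ic b c).
have i2 := integrable_prodM (ic a (pi / 2)) (ic b (c + pi / 2)).
have e : (fun u : R * R => cos (a * u.1 + b * u.2 + c)) =
    (fun u => cos (a * u.1 + 0) * cos (b * u.2 + c) -
              cos (a * u.1 + pi / 2) * cos (b * u.2 + (c + pi / 2))).
  apply/funext => u; rewrite addr0 [b * u.2 + (c + _)]addrA !cosDpihalf.
  by rewrite mulrNN -addrA cosD.
rewrite e; split; first exact: (integrableB measurableT i1 i2).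
rewrite RintegralB// (Rintegral_prodM (ic _ _) (ic _ _)).
rewrite (Rintegral_prodM (ic _ _) (ic _ _)) !charfun_normal cos_pihalf.
rewrite !mul0r subr0 cos0 mul1r mulrCA -expRD; congr (_ * expR _).
by field.
Qed.

End GaussianMoments.

Section BivariateGaussian.
Context {d : measure_display} {T : measurableType d} {R : realType}.
Variable P : probability T R.

Local Notation gamma := (@normal_prob R 0 1).
Local Notation Gamma := (gamma \x gamma)%E.

Section Law.
Context {Y Z : T -> R} {m1 m2 a11 a12 a21 a22 : R}.
Hypothesis mY : measurable_fun setT Y.
Hypothesis mZ : measurable_fun setT Z.

Let aff (u : R * R) : R * R :=
  (m1 + a11 * u.1 + a12 * u.2, m2 + a21 * u.1 + a22 * u.2).

Hypothesis law : forall A : set (R * R), measurable A ->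
  pushforward P (fun w => (Y w, Z w)) A = pushforward Gamma aff A.

Let measurable_aff : measurable_fun setT aff.
Proof.
apply: measurable_fun_pair.
  by apply: measurable_funD; [apply: measurable_funD => //|];
    apply: measurable_funM.
by apply: measurable_funD; [apply: measurable_funD => //|];
  apply: measurable_funM.
Qed.

Let measurable_YZ : measurable_fun setT (fun w => (Y w, Z w)).
Proof. exact: measurable_fun_pair. Qed.

Lemma ge0_integral_law (h : R * R -> \bar R) :
  measurable_fun setT h -> (forall u, 0 <= h u)%E ->
  (\int[P]_w h (Y w, Z w) = \int[Gamma]_u h (aff u))%E.
Proof.
move=> mh h0.
transitivity (\int[pushforward P (fun w => (Y w, Z w))]_u h u)%E.
  by rewrite ge0_integral_pushforward.
rewrite (eq_measure_integral (pushforward Gamma aff)).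
  by rewrite ge0_integral_pushforward.
by move=> A mA _; exact: law.
Qed.

Lemma integrable_law (h : R * R -> R) : measurable_fun setT h ->
  Gamma.-integrable setT (fun u => (h (aff u))%:E) ->
  P.-integrable setT (fun w => (h (Y w, Z w))%:E).
Proof.
move=> mh hi; apply/integrableP; split.
  by apply/measurable_EFinP; apply: (measurableT_comp mh).
rewrite (@ge0_integral_law (fun u => `|(h u)%:E|)%E)//; last first.
  by apply: measurableT_comp => //; exact/measurable_EFinP.
by have /integrableP[] := hi.
Qed.

Lemma Rintegral_law (h : R * R -> R) : measurable_fun setT h ->
  Gamma.-integrable setT (fun u => (h (aff u))%:E) ->
  \int[P]_w h (Y w, Z w) = \int[Gamma]_u h (aff u).
Proof.
move=> mh hi; rewrite /Rintegral.
have mh' : measurable_fun setT (EFin \o h) by exact/measurable_EFinP.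
transitivity (fine (\int[pushforward P (fun w => (Y w, Z w))]_u (h u)%:E))%E.
  by rewrite integral_pushforward//; exact: integrable_law.
rewrite (eq_measure_integral (pushforward Gamma aff)).
  by rewrite integral_pushforward.
by move=> A mA _; exact: law.
Qed.

End Law.

(** The coefficients of the affine map are not determined by the law. The characteristic function
    sees them only through means, variances and covariance, so they are eliminated here once and for
    all. *)
Lemma bivariate_gaussian_moments {Y Z : T -> R} :
  measurable_fun setT Y -> measurable_fun setT Z -> bivariate_gaussian P Y Z ->
  Y \in Lfun P 2%:E /\
  forall s t c : R,
  \int[P]_w cos (s * Y w + t * Z w + c) =
  cos (s * \int[P]_w Y w + t * \int[P]_w Z w + c) *
  expR (- ((s ^+ 2 * fine 'V_P[Y] + 2 * (s * t) * fine (covariance P Y Z)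
     + t ^+ 2 * fine 'V_P[Z]) / 2)).
Proof.
move=> mY mZ [m1 [m2 [a11 [a12 [a21 [a22 law]]]]]].
have cst2 c : cst c \in Lfun P 2%:E by exact: Lfun_cst.
(* All second moments come from one computation: a centred coordinate pulls back to a linear form in
   the two independent normals. *)
have qu (h1 h2 : R * R -> R) b1 c1 b2 c2 :
  measurable_fun setT h1 -> measurable_fun setT h2 ->
  (forall u, h1 (m1 + a11 * u.1 + a12 * u.2, m2 + a21 * u.1 + a22 * u.2)
     = b1 * u.1 + c1 * u.2) ->
  (forall u, h2 (m1 + a11 * u.1 + a12 * u.2, m2 + a21 * u.1 + a22 * u.2)
     = b2 * u.1 + c2 * u.2) ->
  P.-integrable setT (fun w => (h1 (Y w, Z w) * h2 (Y w, Z w))%:E) /\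
  \int[P]_w (h1 (Y w, Z w) * h2 (Y w, Z w)) = b1 * b2 + c1 * c2.
  move=> mh1 mh2 e1 e2.
  have mh : measurable_fun setT (h1 \* h2) by exact: measurable_funM.
  have [qi qE] := Gamma_quadratic b1 c1 b2 c2.
  have hi : Gamma.-integrable setT (fun u =>
    ((h1 \* h2) (m1 + a11 * u.1 + a12 * u.2, m2 + a21 * u.1 + a22 * u.2))%:E).
    by under eq_fun do rewrite /= e1 e2.
  split; first exact: (integrable_law mY mZ law mh hi).
  rewrite (Rintegral_law mY mZ law mh hi) -qE.
  by apply: eq_Rintegral => u _; rewrite /= e1 e2.
have li (h1 : R * R -> R) b1 c1 :
  measurable_fun setT h1 ->
  (forall u, h1 (m1 + a11 * u.1 + a12 * u.2, m2 + a21 * u.1 + a22 * u.2)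
     = b1 * u.1 + c1 * u.2) ->
  \int[P]_w (h1 (Y w, Z w)) = 0.
  move=> mh e1.
  have [qi qE] := Gamma_linear b1 c1.
  rewrite (Rintegral_law mY mZ law mh).
    by rewrite -[RHS]qE; apply: eq_Rintegral => u _; rewrite e1.
  by under eq_fun do rewrite e1.
pose hY (u : R * R) := u.1 - m1; pose hZ (u : R * R) := u.2 - m2.
have mhY : measurable_fun setT hY by exact: measurable_funB.
have mhZ : measurable_fun setT hZ by exact: measurable_funB.
have eY u : hY (m1 + a11 * u.1 + a12 * u.2, m2 + a21 * u.1 + a22 * u.2) =
  a11 * u.1 + a12 * u.2.
  by rewrite /hY /=; ring.
have eZ u : hZ (m1 + a11 * u.1 + a12 * u.2, m2 + a21 * u.1 + a22 * u.2) =
  a21 * u.1 + a22 * u.2.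
  by rewrite /hZ /=; ring.
have [iYY EYY] := qu hY hY _ _ _ _ mhY mhY eY eY.
have [iZZ EZZ] := qu hZ hZ _ _ _ _ mhZ mhZ eZ eZ.
have [iYZ EYZ] := qu hY hZ _ _ _ _ mhY mhZ eY eZ.
have EY := li _ _ _ mhY eY; have EZ := li _ _ _ mhZ eZ.
have L2 (X : T -> R) m : measurable_fun setT X ->
    P.-integrable setT (fun w =>
      ((X w - m) * (X w - m))%:E) -> X \in Lfun P 2%:E.
  move=> mX iX.
  have : (fun w => X w - m) \in Lfun P 2%:E.
    by apply: Lfun2_of_sqr => //; exact: measurable_funB.
  move=> h; have -> : X = (fun w => X w - m) \+ cst m.
    by apply/funext => w /=; rewrite subrK.
  by rewrite rpredD ?lee1n.
have Y2 := L2 _ _ mY iYY; have Z2 := L2 _ _ mZ iZZ.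
have EX (X : T -> R) m : X \in Lfun P 2%:E -> \int[P]_w (X w - m) = 0 ->
    \int[P]_w X w = m.
  move=> X2; rewrite RintegralB//;
    [|exact: Lfun2_integrable|exact: (Lfun2_integrable (cst2 m))].
  rewrite Rintegral_cst// (_ : fine (P setT) = 1) ?mulr1; last first.
    by rewrite -[RHS]/(fine 1%:E); congr fine; exact: probability_setT.
  by move/eqP; rewrite subr_eq0 => /eqP.
have mY1 := EX _ _ Y2 EY; have mZ1 := EX _ _ Z2 EZ.
have cE (X1 X2 : T -> R) n1 n2 : \int[P]_w X1 w = n1 -> \int[P]_w X2 w = n2 ->
    fine (covariance P X1 X2) = \int[P]_w ((X1 w - n1) * (X2 w - n2)).
  by move=> <- <-; rewrite unlock [in LHS]unlock.
split=> // s t c.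
rewrite /variance (cE _ _ _ _ mY1 mY1) (cE _ _ _ _ mY1 mZ1) (cE _ _ _ _ mZ1
  mZ1).
rewrite EYY EZZ EYZ mY1 mZ1.
have [ci cosE] := Gamma_cos (s * a11 + t * a21) (s * a12 + t * a22) (s * m1 +
  t * m2 + c).
pose h (u : R * R) := cos (s * u.1 + t * u.2 + c).
have mh : measurable_fun setT h.
  have -> : h = (fun y => cos (1 * y + c)) \o (fun u => s * u.1 + t * u.2).
    by apply/funext => u /=; rewrite mul1r.
  apply: measurableT_comp; first exact: measurable_cosaff.
  by apply: measurable_funD; apply: measurable_funM.
have he u : h (m1 + a11 * u.1 + a12 * u.2, m2 + a21 * u.1 + a22 * u.2) =
   cos ((s * a11 + t * a21) * u.1 + (s * a12 + t * a22) * u.2 + (s * m1 + t *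
     m2 + c)).
  by rewrite /h /=; congr cos; ring.
rewrite -[LHS]/(\int[P]_w h (Y w, Z w)) (Rintegral_law mY mZ law mh);
  last first.
  by under eq_fun do rewrite he.
under eq_Rintegral do rewrite he.
by rewrite cosE; congr (_ * expR _); field.
Qed.

End BivariateGaussian.

(** * Density of trigonometric polynomials *)

Section TrigPolyDensity.
Context {d : measure_display} {T : measurableType d} {R : realType}.
Variables (P : probability T R) (X : T -> R).
Hypothesis mX : measurable_fun setT X.
Implicit Types (f h : R -> R) (q r : seq (R * R * R)).

(** Entries are amplitude, frequency and phase. Phases take care of sines, and concatenation of
    lists is addition. *)
Definition trig_poly q (x : R) : R :=
  \sum_(a <- q) a.1.1 * cos (a.1.2 * x + a.2).

(** The squared L^2 norm under the law of [X], extended-valued so that it makes sense before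
    integrability is known. *)
Definition nsq f : \bar R := (\int[P]_w ((f (X w)) ^+ 2)%:E)%E.

Definition trig_approx f : Prop :=
  forall e : R, 0 < e ->
    exists q, (nsq (fun x => (f x - trig_poly q x)%R) < e%:E)%E.

(** Boundedness is kept because multiplication by a fixed bounded function is continuous in L^2; it
    makes this class an algebra closed under uniformly bounded pointwise limits. *)
Definition bapprox f : Prop :=
  [/\ measurable_fun setT f, exists C, forall x, `|f x| <= C & trig_approx f].

Lemma measurable_trig_poly q : measurable_fun setT (trig_poly q).
Proof.
rewrite /trig_poly; apply: measurable_sum => a.
by apply: measurable_funM => //; exact: measurable_cosaff.
Qed.

Lemma trig_poly_bounded q : exists C, forall x, `|trig_poly q x| <= C.
Proof.
exists (\sum_(a <- q) `|a.1.1|) => x.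
rewrite (le_trans (ler_norm_sum _ _ _))// ler_sum// => a _.
by rewrite normrM (le_trans (ler_wpM2l _ (normr_cos_le1 _)))// mulr1.
Qed.

Lemma trig_poly_cat q r x :
  trig_poly (q ++ r) x = trig_poly q x + trig_poly r x.
Proof. by rewrite /trig_poly big_cat. Qed.

Lemma cosM (x y : R) : cos x * cos y = 2^-1 * cos (x + y) + 2^-1 * cos (x - y).
Proof. by rewrite cosD cosB; field. Qed.

Lemma trig_polyM q r : exists s, forall x, trig_poly s x =
  trig_poly q x * trig_poly r x.
Proof.
elim: q => [|[[c t] u] q [s IH]].
  by exists [::] => x; rewrite /trig_poly !big_nil mul0r.
exists ([seq (c * a.1.1 / 2, t + a.1.2, u + a.2) | a <- r] ++
        [seq (c * a.1.1 / 2, t - a.1.2, u - a.2) | a <- r] ++ s) => x.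
rewrite !trig_poly_cat {}IH [trig_poly (_ :: _) x]/trig_poly big_cons mulrDl.
rewrite addrA; congr (_ + _).
rewrite /trig_poly !big_map -big_split mulr_sumr; apply: eq_bigr => a _ /=.
rewrite mulrACA cosM.
rewrite (_ : t * x + u + (a.1.2 * x + a.2) = (t + a.1.2) * x + (u + a.2));
  last by ring.
rewrite (_ : t * x + u - (a.1.2 * x + a.2) = (t - a.1.2) * x + (u - a.2));
  last by ring.
by field.
Qed.

Lemma measurable_nsq f : measurable_fun setT f ->
  measurable_fun setT (fun w => ((f (X w)) ^+ 2)%:E).
Proof.
move=> mf; apply/measurable_EFinP; apply: measurable_funX.
exact: (measurableT_comp mf).
Qed.

Lemma le_nsq f h (C : R) : measurable_fun setT f -> measurable_fun setT h ->
  (forall x, f x ^+ 2 <= C * h x ^+ 2) -> 0 <= C ->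
  (nsq f <= C%:E * nsq h)%E.
Proof.
move=> mf mh fh C0; rewrite /nsq -ge0_integralZl_EFin//; last 2 first.
- by move=> w _; rewrite lee_fin sqr_ge0.
- exact: measurable_nsq.
apply: ge0_le_integral => //.
- by move=> w _; rewrite lee_fin sqr_ge0.
- exact: measurable_nsq.
- by apply/measurable_EFinP; apply: measurable_funM => //;
  apply/measurable_EFinP; exact: measurable_nsq.
- by move=> w _; rewrite -EFinM lee_fin.
Qed.

(** From [(a + b)^2 <= 2 a^2 + 2 b^2]. It replaces the triangle inequality without square roots and
    accounts for the [e / 4] in the approximations below. *)
Lemma nsqD f (g : R -> R) h : measurable_fun setT f -> measurable_fun setT g ->
  measurable_fun setT h ->
  (forall x, f x = g x + h x) -> (nsq f <= 2%:E * nsq g + 2%:E * nsq h)%E.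
Proof.
move=> mf mg mh fgh; rewrite /nsq.
have c2 : (0 <= 2 :> R) by [].
rewrite -!ge0_integralZl_EFin//; try by [move=> w _;
  rewrite lee_fin sqr_ge0 | exact: measurable_nsq].
have m2 (k : R -> R) : measurable_fun setT k -> measurable_fun setT (fun w =>
  (2%:E * (k (X w) ^+ 2)%:E)%E).
  by move=> mk; apply/measurable_EFinP; apply: measurable_funM => //;
    apply/measurable_EFinP; exact: measurable_nsq.
rewrite -ge0_integralD//; try by [move=> w _;
  rewrite -EFinM lee_fin mulr_ge0// sqr_ge0 | exact: m2].
apply: ge0_le_integral => //.
- by move=> w _; rewrite lee_fin sqr_ge0.
- exact: measurable_nsq.
- by apply: emeasurable_funD; exact: m2.
- move=> w _; rewrite -!EFinM -EFinD lee_fin fgh.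
  by have := sqr_ge0 (g (X w) - h (X w)); nra.
Qed.

Lemma trig_approx_poly q : trig_approx (trig_poly q).
Proof.
move=> e e0; exists q; rewrite /nsq.
under eq_integral do rewrite subrr expr0n.
by rewrite integral0.
Qed.

Lemma trig_approx_trans f : measurable_fun setT f ->
  (forall e : R, 0 < e -> exists h, [/\ measurable_fun setT h, trig_approx h &
     (nsq (fun x => (f x - h x)%R) < e%:E)%E]) -> trig_approx f.
Proof.
move=> mf H e e0; have e4 : 0 < e / 4 by rewrite divr_gt0.
have [h [mh ha fh]] := H _ e4; have [q hq] := ha _ e4.
exists q; have mq := measurable_trig_poly q.
apply: le_lt_trans (@nsqD _ (fun x => f x - h x) (fun x =>
  h x - trig_poly q x) _ _ _ _) _.
- exact: measurable_funB.
- exact: measurable_funB.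
- exact: measurable_funB.
- by move=> x; rewrite subrKA.
have -> : e%:E = (2%:E * (e / 4)%:E + 2%:E * (e / 4)%:E)%E.
  by rewrite -!EFinM -EFinD; congr EFin; field.
by apply: lteD; rewrite lte_pmul2l.
Qed.

Lemma trig_approxD f h : measurable_fun setT f -> measurable_fun setT h ->
  trig_approx f -> trig_approx h -> trig_approx (fun x => f x + h x).
Proof.
move=> mf mh fa ha e e0; have e4 : 0 < e / 4 by rewrite divr_gt0.
have [q fq] := fa _ e4; have [r hr] := ha _ e4.
exists (q ++ r); have mq := measurable_trig_poly q;
  have mr := measurable_trig_poly r.
apply: le_lt_trans (@nsqD _ (fun x => f x - trig_poly q x) (fun x =>
  h x - trig_poly r x) _ _ _ _) _.
- by apply: measurable_funB;
  [exact: measurable_funD|exact: measurable_trig_poly].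
- exact: measurable_funB.
- exact: measurable_funB.
- by move=> x; rewrite trig_poly_cat; ring.
have -> : e%:E = (2%:E * (e / 4)%:E + 2%:E * (e / 4)%:E)%E.
  by rewrite -!EFinM -EFinD; congr EFin; field.
by apply: lteD; rewrite lte_pmul2l.
Qed.

Lemma trig_approx_mul_poly f q : measurable_fun setT f -> trig_approx f ->
  trig_approx (fun x => f x * trig_poly q x).
Proof.
move=> mf fa e e0; have [C qC] := trig_poly_bounded q.
pose D := C ^+ 2 + 1.
have D0 : 0 < D by rewrite ltr_wpDl// sqr_ge0.
have [r fr] := fa (e / D) (divr_gt0 e0 D0).
have [s sE] := trig_polyM r q; exists s.
apply: le_lt_trans (@le_nsq _ (fun x => f x - trig_poly r x) D _ _ _ _) _.
- apply: measurable_funB; last exact: measurable_trig_poly.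
  by apply: measurable_funM => //; exact: measurable_trig_poly.
- by apply: measurable_funB => //; exact: measurable_trig_poly.
- move=> x; rewrite sE -mulrBl exprMn mulrC ler_wpM2r ?sqr_ge0//.
  rewrite /D -(real_normK (num_real (trig_poly q x))).
  by have := qC x; have := normr_ge0 (trig_poly q x); nra.
- exact: ltW.
by rewrite muleC -lte_pdivlMr// in fr *; rewrite -EFinM divfK ?gt_eqF.
Qed.

Lemma trig_approxZ c f : measurable_fun setT f -> trig_approx f ->
  trig_approx (fun x => c * f x).
Proof.
move=> mf fa; have := trig_approx_mul_poly [:: (c, 0, 0)] mf fa.
congr trig_approx; apply/funext => x.
by rewrite /trig_poly big_seq1 /= mul0r addr0 cos0 mulr1 mulrC.
Qed.

(** The approximants of [f] need not share a bound, so the two factors are not approximated at once: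
    [h] is replaced by some [trig_poly r] against the bounded [f], then [f] is approximated against
    that fixed polynomial. *)
Lemma bapproxM f h : bapprox f -> bapprox h -> bapprox (fun x => f x * h x).
Proof.
move=> [mf [C fC] fa] [mh [D hD] ha]; split.
- exact: measurable_funM.
- exists (C * D) => x; rewrite normrM ler_pM//.
- apply: trig_approx_trans; first exact: measurable_funM.
  move=> e e0; pose K := C ^+ 2 + 1.
  have K0 : 0 < K by rewrite ltr_wpDl// sqr_ge0.
  have [r hr] := ha (e / K) (divr_gt0 e0 K0).
  exists (fun x => f x * trig_poly r x); split.
  + by apply: measurable_funM => //; exact: measurable_trig_poly.
  + exact: trig_approx_mul_poly.
  + apply: le_lt_trans (@le_nsq _ (fun x => h x - trig_poly r x) K _ _ _ _) _.
    * apply: measurable_funB; first exact: measurable_funM.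
      by apply: measurable_funM => //; exact: measurable_trig_poly.
    * by apply: measurable_funB => //; exact: measurable_trig_poly.
    * move=> x; rewrite -mulrBr exprMn ler_wpM2r ?sqr_ge0//.
      rewrite /K -(real_normK (num_real (f x))).
      by have := fC x; have := normr_ge0 (f x); nra.
    * exact: ltW.
    by rewrite muleC -lte_pdivlMr// in hr *; rewrite -EFinM divfK ?gt_eqF.
Qed.

Lemma bapproxD f h : bapprox f -> bapprox h -> bapprox (fun x => f x + h x).
Proof.
move=> [mf [C fC] fa] [mh [D hD] ha]; split.
- exact: measurable_funD.
- by exists (C + D) => x; rewrite (le_trans (ler_normD _ _))// lerD.
- exact: trig_approxD.
Qed.

Lemma bapprox_poly q : bapprox (trig_poly q).
Proof.
split; [exact: measurable_trig_poly|exact: trig_poly_bounded|].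
exact: trig_approx_poly.
Qed.

Lemma bapprox_cosaff t c : bapprox (fun x => cos (t * x + c)).
Proof.
have := bapprox_poly [:: (1, t, c)]; congr bapprox; apply/funext => x.
by rewrite /trig_poly big_seq1 /= mul1r.
Qed.

Lemma bapprox_cst c : bapprox (fun _ => c).
Proof.
have := bapprox_poly [:: (c, 0, 0)]; congr bapprox; apply/funext => x.
by rewrite /trig_poly big_seq1 /= mul0r addr0 cos0 mulr1.
Qed.

Lemma trig_approx_lim (f_ : nat -> R -> R) f (G : R -> R) :
  (forall n, measurable_fun setT (f_ n)) -> (forall n, trig_approx (f_ n)) ->
  (forall x, f_ n x @[n --> \oo] --> f x) ->
  P.-integrable setT (fun w => (G (X w))%:E) ->
  (forall n x, (f x - f_ n x) ^+ 2 <= G x) ->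
  trig_approx f.
Proof.
move=> mf_ fa ff iG fG.
have mf : measurable_fun setT f by apply: (measurable_fun_cvg mf_) => x _;
  exact: ff.
apply: trig_approx_trans => // e e0.
have : (\int[P]_w ((f (X w) - f_ n (X w)) ^+ 2)%:E)%E @[n --> \oo] -->
  (\int[P]_w (cst 0 w))%E.
  apply: (@dominated_cvg _ _ _ P setT measurableT
    (fun n w => ((f (X w) - f_ n (X w)) ^+ 2)%:E) (cst 0%E) (fun w =>
      (G (X w))%:E)) => //.
  - by move=> n; apply: (@measurable_nsq (fun x => f x - f_ n x));
    exact: measurable_funB.
  - move=> w _; apply/fine_cvgP; split; first exact: nearW.
    have c0 : f (X w) - f_ n (X w) @[n --> \oo] --> 0.
      by rewrite -(subrr (f (X w))); apply: cvgB; [exact: cvg_cst|exact: ff].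
    by have := cvgM c0 c0; rewrite mulr0 => /(_ _) h; exact: h.
  - by move=> n w _; rewrite gee0_abs lee_fin ?sqr_ge0.
rewrite integral0 => cv.
have [N _ HN] : \forall n \near \oo,
  (\int[P]_w ((f (X w) - f_ n (X w)) ^+ 2)%:E < e%:E)%E.
  have := cv (fun y => (y < e%:E)%E); apply.
  by apply: open_nbhs_nbhs; split;
    [exact: open_ereal_lt_ereal|rewrite /= lte_fin].
by exists (f_ N); split => //; exact: (HN N (leqnn N)).
Qed.

Lemma bapprox_lim (C : R) (f_ : nat -> R -> R) f :
  (forall n, bapprox (f_ n)) -> (forall n x, `|f_ n x| <= C) ->
  (forall x, f_ n x @[n --> \oo] --> f x) -> bapprox f.
Proof.
move=> fb fC ff.
have mf_ n : measurable_fun setT (f_ n) by case: (fb n).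
have mf : measurable_fun setT f by apply: (measurable_fun_cvg mf_) => x _;
  exact: ff.
have C0 : 0 <= C by apply: le_trans (fC 0%N 0).
have fC' x : `|f x| <= C.
  have /cvg_lim <- // : `|f_ n x| @[n --> \oo] --> `|f x| by apply: cvg_norm;
    exact: ff.
  apply: limr_le; last by apply: nearW => n; exact: fC.
  by apply: is_cvg_norm; apply/cvg_ex; exists (f x); exact: ff.
split=> //; first by exists C.
apply: (@trig_approx_lim f_ f (fun=> (2 * C) ^+ 2)) => //.
- by move=> n; case: (fb n).
- by apply: (@bounded_integrable _ _ _ P _ ((2 * C) ^+ 2)) => // w;
  rewrite ger0_norm ?sqr_ge0.
- move=> n x; rewrite -(real_normK (num_real (f x - f_ n x))) ler_sqr ?nnegrE
  ?mulr_ge0//.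
  by rewrite (le_trans (ler_normB _ _))// mulr2n mulrDl mul1r lerD.
Qed.

End TrigPolyDensity.

(** * A polynomial iteration converging to the sign *)

Section SignIteration.
Context {R : realType}.

(** The Newton-Schulz step for the sign: it maps [[-1, 1]] to itself, fixes -1, 0 and 1 and is flat
    at the ends. Its iterates drive every positive point of the interval to 1 and remain polynomials
    in the starting point. *)
Definition sign_step (t : R) : R := (3 * t - t ^+ 3) / 2.

Lemma sign_stepN t : sign_step (- t) = - sign_step t.
Proof. by rewrite /sign_step; field. Qed.

Lemma iter_sign_stepN n t : iter n sign_step (- t) = - iter n sign_step t.
Proof. by elim: n => //= n ->; exact: sign_stepN. Qed.

Lemma iter_sign_step_itv n (t : R) : 0 < t -> t <= 1 ->
  [/\ t <= iter n sign_step t, iter n sign_step t <= 1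
    & 1 - iter n sign_step t <= (1 - t / 2) ^+ n].
Proof.
move=> t0 t1; elim: n => [|n [IH1 IH2 IH3]] /=; first by rewrite expr0; split;
  lra.
set s := iter n sign_step t in IH1 IH2 IH3 *.
have E1 : sign_step s - s = s * (1 - s) * (1 + s) / 2 by rewrite /sign_step;
  field.
(* The second factor equals [1 - s / 2 - s^2 / 2], at most [1 - t / 2] because [t <= s]: the
   starting point fixes the contraction rate. *)
have E2 : 1 - sign_step s = (1 - s) * ((1 - s) * (2 + s) / 2).
  by rewrite /sign_step; field.
have s0 : 0 < s by apply: lt_le_trans IH1.
have s1 : 0 <= 1 - s by rewrite subr_ge0.
split.
- apply: le_trans IH1 _; rewrite -subr_ge0 E1 divr_ge0// !mulr_ge0// ?ltW//.
  by rewrite addr_gt0.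
- rewrite -subr_ge0 E2 !mulr_ge0// ?divr_ge0// ?mulr_ge0// addr_ge0// ltW//.
- rewrite E2 exprSr ler_pM//.
  + by rewrite divr_ge0// mulr_ge0// addr_ge0// ltW.
  + by nra.
Qed.

Lemma iter_sign_step_le1 n (t : R) : `|t| <= 1 -> `|iter n sign_step t| <= 1.
Proof.
rewrite !ler_norml; case: (ltrgt0P t) => [t0 /andP[_ t1]|t0 /andP[t1 _]|->].
- have [h1 h2 _] := iter_sign_step_itv n t0 t1.
  by rewrite h2 andbT; lra.
- have tN0 : 0 < - t by lra.
  have tN1 : - t <= 1 by lra.
  have [h1 h2 _] := iter_sign_step_itv n tN0 tN1.
  by rewrite iter_sign_stepN in h1 h2; lra.
- suff -> : iter n sign_step 0 = 0 by [].
  by elim: n => //= n ->; rewrite /sign_step expr0n mulr0 subr0 mul0r.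
Qed.

Lemma cvg_iter_sign_step_pos (t : R) : 0 < t -> t <= 1 ->
  iter n sign_step t @[n --> \oo] --> (1 : R).
Proof.
move=> t0 t1; apply/subr_cvg0; apply: norm_cvg0.
apply: (@squeeze_cvgr nat \oo _ R (fun=> 0) (fun n => (1 - t / 2) ^+ n)
  (fun n => `|iter n sign_step t - 1|)).
- apply: nearW => n; have [_ h2 h3] := iter_sign_step_itv n t0 t1.
  by rewrite normr_ge0 distrC ger0_norm ?subr_ge0.
- exact: cvg_cst.
- by apply: cvg_expr; rewrite ger0_norm; lra.
Qed.

Lemma cvg_iter_sign_step (t : R) : `|t| <= 1 ->
  iter n sign_step t @[n --> \oo] --> Num.sg t.
Proof.
rewrite ler_norml; case: (ltrgt0P t) => [t0 /andP[_ t1]|t0 /andP[t1 _]|-> _].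
- by rewrite gtr0_sg//; exact: cvg_iter_sign_step_pos.
- rewrite ltr0_sg//.
  have -> : (fun n => iter n sign_step t) = (fun n => - iter n sign_step (- t)).
    by apply/funext => n; rewrite iter_sign_stepN opprK.
  by apply: cvgN; apply: cvg_iter_sign_step_pos; lra.
- rewrite sgr0; have -> : (fun n => iter n sign_step 0) = (fun=> 0).
    by apply/funext; elim=> //= n ->;
      rewrite /sign_step expr0n mulr0 subr0 mul0r.
  exact: cvg_cst.
Qed.

End SignIteration.

(** * From signs to indicators to square-integrable functions *)

Section TrigPolyDense.
Import HBNNSimple.
Context {d : measure_display} {T : measurableType d} {R : realType}.
Variables (P : probability T R) (X : T -> R).
Hypothesis mX : measurable_fun setT X.

Local Notation bapprox := (bapprox P X).

Lemma bapprox_sign_step (f : R -> R) :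
  bapprox f -> bapprox (fun x => sign_step (f x)).
Proof.
move=> fb; have fff := bapproxM mX (bapproxM mX fb fb) fb.
have := bapproxD mX (bapproxM mX (bapprox_cst P X (3 / 2)) fb)
   (bapproxM mX (bapprox_cst P X (- 2^-1)) fff).
by congr bapprox; apply/funext => x; rewrite /sign_step; field.
Qed.

Lemma bapprox_sg (f : R -> R) : bapprox f -> (forall x, `|f x| <= 1) ->
  bapprox (fun x => Num.sg (f x)).
Proof.
move=> fb f1.
apply: (@bapprox_lim _ _ _ P X mX 1 (fun n x => iter n sign_step (f x))).
- by elim=> [|n IH] //=; exact: bapprox_sign_step.
- by move=> n x; exact: iter_sign_step_le1.
- by move=> x; exact: cvg_iter_sign_step.
Qed.

Lemma sg_sin_pos (y : R) : 0 < y -> y <= 1 -> Num.sg (sin y) = 1.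
Proof.
move=> y0 y1; rewrite gtr0_sg// sin_gt0_pi// y0 /=.
by rewrite (le_lt_trans y1)// (lt_le_trans _ (pi_ge2 R))// ltr1n.
Qed.

Lemma sg_sin (y : R) : `|y| <= 1 -> Num.sg (sin y) = Num.sg y.
Proof.
rewrite ler_norml; case: (ltrgt0P y) => [y0 /andP[_ y1]|y0 /andP[y1 _]|-> _].
- by rewrite sg_sin_pos// gtr0_sg.
- have h : Num.sg (sin (- y)) = 1 by apply: sg_sin_pos; lra.
  by rewrite -[in LHS](opprK y) sinN sgrN h ltr0_sg.
- by rewrite sin0.
Qed.

(* The indicator is [(s + s ^ 2) / 2] with [s =
  sg (x - a)], and [s] is the limit
   of [sg (sin ((x - a) / n))], each an iterated limit of trigonometric
   polynomials. *)
Lemma bapprox_ray (a : R) : bapprox (\1_(`]a, +oo[%classic)).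
Proof.
have sb : bapprox (fun x => Num.sg (x - a)).
  apply: (@bapprox_lim _ _ _ P X mX 1 (fun n x =>
    Num.sg (sin ((x - a) / n.+1%:R)))).
  - move=> n; apply: bapprox_sg => [|x]; last exact: normr_sin_le1.
    have := bapprox_cosaff P X (n.+1%:R^-1) (- a / n.+1%:R - pi / 2).
    congr bapprox; apply/funext => x; rewrite -cosBpihalf; congr cos; field.
    by rewrite addrC natr1 pnatr_eq0.
  - by move=> n x; rewrite normr_sg; case: eqP.
  (* Once [n >= |x - a|] the argument lies in [[-1, 1]], where the sine has the sign of its
     argument: the sequence is eventually constant. *)
  - move=> x; apply: cvg_near_cst; near=> n; rewrite sg_sin.
      by rewrite sgrM (@gtr0_sg _ (n.+1%:R^-1)) ?mulr1.
    rewrite normrM normfV [`|n.+1%:R|]ger0_norm// ler_pdivrMr// mul1r.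
    apply: le_trans (_ : n%:R <= _); last by rewrite ler_nat.
    by near: n; exact: nbhs_infty_ger.
have := bapproxM mX (bapprox_cst P X (2^-1)) (bapproxD mX sb (bapproxM mX sb
  sb)).
congr bapprox; apply/funext => x; rewrite indicE mem_setE in_itv /= andbT.
rewrite -subr_gt0; case: (ltrgt0P (x - a)) => [h|h|->].
- by rewrite gtr0_sg// -[RHS]/(1 : R); field.
- by rewrite ltr0_sg// -[RHS]/(0 : R); field.
- by rewrite sgr0 -[RHS]/(0 : R); field.
Unshelve. all: by end_near. Qed.

(** The sets with [bapprox] indicator form a sigma-algebra: complements are affine, intersections
    are products, and countable unions are bounded limits of finite ones. It contains the open rays,
    which generate the Borel sets. *)
Lemma bapprox_indic (A : set R) : measurable A -> bapprox (\1_A).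
Proof.
have -> : measurable A = <<s @RGenOInfty.G R >> A.
  by have /(congr1 (@^~ A)) := RGenOInfty.measurableE R.
move: A; apply: smallest_sub; last first.
  by move=> A [a ->]; exact: bapprox_ray.
have setC_b (A : set R) : bapprox (\1_A) -> bapprox (\1_(~` A)).
  move=> Ab; have := bapproxD mX (bapprox_cst P X 1) (bapproxM mX (bapprox_cst
    P X (- 1)) Ab).
  congr bapprox; apply/funext => x; rewrite !indicE in_setC.
  by case: (x \in A) => /=; ring.
have setU_b (A B : set R) :
  bapprox (\1_A) -> bapprox (\1_B) -> bapprox (\1_(A `|` B)).
  move=> Ab Bb; rewrite -[_ `|` _]setCK setCU; apply: (setC_b (~` A `&` ~` B)).
  by rewrite indicI; exact: (bapproxM mX (setC_b _ Ab) (setC_b _ Bb)).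
have b0 : bapprox (\1_set0).
  by have := bapprox_cst P X 0; congr bapprox; apply/funext => x;
    rewrite indic0.
split => //.
- by move=> A Ab; rewrite setTD; exact: setC_b.
- move=> A Ab.
  apply: (@bapprox_lim _ _ _ P X mX 1 (fun n =>
    \1_(\big[setU/set0]_(k < n) A k))).
  + elim=> [|n IH]; first by rewrite big_ord0.
    by rewrite big_ord_recr /=; exact: setU_b.
  + by move=> n x; rewrite indicE; case: (_ \in _); rewrite ?normr0 ?normr1.
  + move=> x; apply: cvg_near_cst;
    have [[k _ Akx]|nA] := pselect ((\bigcup_k A k) x).
      near=> n; rewrite !indicE !mem_set//; first by exists k.
      by rewrite -bigcup_mkord; exists k => //=; near: n; exists k.+1.
    apply: nearW => n; rewrite !indicE !memNset//.
    by rewrite -bigcup_mkord => -[k _ Akx]; apply: nA; exists k.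
Unshelve. all: by end_near. Qed.

Lemma bapprox_sum (I : Type) (s : seq I) (F : I -> R -> R) :
  (forall i, bapprox (F i)) -> bapprox (fun x => \sum_(i <- s) F i x).
Proof.
move=> Fb; elim: s => [|i s IH].
  by have := bapprox_cst P X 0; congr bapprox; apply/funext => x;
    rewrite big_nil.
have := bapproxD mX (Fb i) IH.
by congr bapprox; apply/funext => x; rewrite big_cons.
Qed.

(** Simple functions increase to [f] from below, hence [(f - h n)^2 <= f^2], an integrable bound for
    dominated convergence. *)
Lemma ge0_trig_approx (f : R -> R) :
  measurable_fun setT f -> (forall x, 0 <= f x) ->
  P.-integrable setT (fun w => (f (X w) ^+ 2)%:E) -> trig_approx P X f.
Proof.
move=> mf f0 fi.
have mEf : measurable_fun [set: R] (EFin \o f) by exact/measurable_EFinP.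
pose h := nnsfun_approx measurableT mEf.
have hb n : bapprox (h n).
  have -> : (h n : R -> R) = (fun x =>
    \sum_(y <- finmap.enum_fset (fset_set (range (h n)))) y * \1_(h n @^-1`
    [set y]) x).
    by apply/funext => x; rewrite [LHS]fimfunE fsbig_finite.
  apply: bapprox_sum => y; apply: (bapproxM mX); first exact: bapprox_cst.
  by apply: bapprox_indic.
have hf x : h n x @[n --> \oo] --> f x.
  have := @cvg_nnsfun_approx _ _ R setT measurableT (EFin \o f) mEf _ x I.
  move=> /(_ _)/fine_cvgP[|_]; last by apply.
  by move=> y _; rewrite lee_fin.
have hle n x : h n x <= f x.
  have nd : nondecreasing_seq (fun n => h n x).
    by move=> m k mk; have /lefP :=
      @nd_nnsfun_approx _ _ R setT measurableT (EFin \o f) mEf _ _ mk; apply.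
  have <- : limn (fun n => h n x) = f x by apply/cvg_lim => //; exact: hf.
  by apply: nondecreasing_cvgn_le => //; apply/cvg_ex; exists (f x); exact: hf.
apply: (@trig_approx_lim _ _ _ P X mX h f (fun x => f x ^+ 2)) => //.
- by move=> n; case: (hb n).
- move=> n x; rewrite ler_sqr ?nnegrE ?subr_ge0// gerBl.
  exact: fun_ge0.
Qed.

Theorem trig_poly_dense (f : R -> R) : measurable_fun setT f ->
  P.-integrable setT (fun w => (f (X w) ^+ 2)%:E) -> trig_approx P X f.
Proof.
move=> mf fi.
have fX : measurable_fun setT (f \o X) by exact: measurableT_comp.
have posi (s : R -> R) : measurable_fun setT s -> (forall x,
  s x ^+ 2 <= f x ^+ 2) ->
   P.-integrable setT (fun w => (s (X w) ^+ 2)%:E).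
  move=> ms sf; apply: le_integrable fi => //.
    by apply/measurable_EFinP; apply: measurable_funX;
      exact: (measurableT_comp ms).
  by move=> w _; rewrite !abse_EFin lee_fin !ger0_norm ?sqr_ge0.
have mpos : measurable_fun setT (fun x =>
  Num.max (f x) 0) by exact: measurable_maxr.
have mneg : measurable_fun setT (fun x => Num.max (- f x) 0).
  by apply: measurable_maxr => //; exact: measurableT_comp.
have a1 := @ge0_trig_approx _ mpos _ (posi _ mpos _).
have a2 := @ge0_trig_approx _ mneg _ (posi _ mneg _).
have mneg' : measurable_fun setT (fun x => - 1 * Num.max (- f x) 0).
  by apply: measurable_funM.
have -> : f = (fun x => Num.max (f x) 0 + (- 1) * Num.max (- f x) 0).
  by apply/funext => x; case: (leP (f x) 0); case: (leP (- f x) 0); lra.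
apply: trig_approxD => //.
- by apply: a1 => x; case: (leP (f x) 0) => h;
  rewrite ?expr0n ?sqr_ge0 ?lexx// ltW.
- apply: trig_approxZ => //.
  by apply: a2 => x; case: (leP (- f x) 0) => h;
    rewrite ?expr0n ?sqr_ge0 ?lexx ?sqrrN// ltW.
Qed.

End TrigPolyDense.

(** * Mehler's formula *)

Section Mehler.
Context {R : realType}.

Lemma cosDmulnpi (x : R) (k : nat) : cos (x + k%:R * pi) = (- 1) ^+ k * cos x.
Proof.
elim: k => [|k IH]; first by rewrite mul0r addr0 expr0 mul1r.
by rewrite -natr1 mulrDl mul1r addrA cosDpi IH exprS mulN1r mulNr.
Qed.

(** Shifting both angles by [k * (pi / 2)] leaves their difference alone and adds [k * pi] to their
    sum. The right side can thus weight the series of [exp z] and [exp (- z)] together, while the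
    left side stays a product of one factor per variable. *)
Lemma cosM_shift (x y : R) (k : nat) :
  cos (x + k%:R * (pi / 2)) * cos (y + k%:R * (pi / 2)) =
  2^-1 * cos (x - y) + 2^-1 * ((- 1) ^+ k * cos (x + y)).
Proof.
rewrite cosM -cosDmulnpi addrC; congr (_ * cos _ + _ * cos _); first by ring.
by field.
Qed.

Context {d : measure_display} {T : measurableType d}.
Variable P : probability T R.

(* [trig_coef Y q k] is [sqrt k`!] times the [k]-th coefficient of [trig_poly q]
   in the orthonormal basis of Hermite polynomials of the standardized [Y]. *)
Definition trig_coef (Y : T -> R) (q : seq (R * R * R)) (k : nat) : R :=
  \sum_(a <- q) a.1.1 * (a.1.2 * L20_norm P Y) ^+ k *
    expR (- (a.1.2 ^+ 2 * fine 'V_P[Y] / 2)) *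
    cos (a.1.2 * \int[P]_w Y w + a.2 + k%:R * (pi / 2)).

Lemma sqr_L20_norm (Y : T -> R) : L20_norm P Y ^+ 2 = fine 'V_P[Y].
Proof. by rewrite /L20_norm sqr_sqrtr// fine_ge0// variance_ge0. Qed.

(** At [k = 0] the term is [u 0 * v 0], which for trigonometric coefficients is the product of the
    two means; covariances start at [k = 1]. *)
Definition mehler_sum (rho : R) (u v : nat -> R) (n : nat) : R :=
  \sum_(0 <= k < n) rho ^+ k / k`!%:R * (u k * v k).

Section Pair.
Variables (Y Z : T -> R).
Hypotheses (mY : measurable_fun setT Y) (mZ : measurable_fun setT Z).
Hypothesis YZ : bivariate_gaussian P Y Z.
Hypotheses (Y0 : L20_norm P Y != 0) (Z0 : L20_norm P Z != 0).

Let rho := correlation P Y Z.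

Lemma mehler_cos (s x t y : R) :
  mehler_sum rho (trig_coef Y [:: (1, s, x)]) (trig_coef Z [:: (1, t, y)]) n
    @[n --> \oo] -->
  \int[P]_w (cos (s * Y w + x) * cos (t * Z w + y)).
Proof.
have [Y2 cf] := bivariate_gaussian_moments mY mZ YZ.
set m := \int[P]_w Y w in cf; set n := \int[P]_w Z w in cf.
set v := fine 'V_P[Y] in cf; set w := fine 'V_P[Z] in cf.
set kappa := fine (covariance P Y Z) in cf.
have kE : kappa = rho * L20_norm P Y * L20_norm P Z.
  rewrite /rho /correlation -/(L20_norm P Y) -/(L20_norm P Z) -/kappa.
  by field; rewrite Y0 Z0.
have mc (a b c : R) : measurable_fun setT (fun w =>
  cos (a * Y w + b * Z w + c)).
  have -> : (fun w => cos (a * Y w + b * Z w + c)) =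
      (fun z => cos (1 * z + c)) \o (fun w => a * Y w + b * Z w).
    by apply/funext => u /=; rewrite mul1r.
  apply: measurableT_comp; first exact: measurable_cosaff.
  by apply: measurable_funD; apply: measurable_funM.
have ic (a b c : R) : P.-integrable setT (fun w =>
  (cos (a * Y w + b * Z w + c))%:E).
  by apply: (@bounded_integrable _ _ _ P _ 1) => // u; exact: normr_cos_le1.
have -> : \int[P]_w (cos (s * Y w + x) * cos (t * Z w + y)) =
   2^-1 * \int[P]_w cos (s * Y w + t * Z w + (x + y)) +
   2^-1 * \int[P]_w cos (s * Y w + (- t) * Z w + (x - y)).
  rewrite -(RintegralZl _ measurableT (ic s t (x + y))).
  rewrite -(RintegralZl _ measurableT (ic s (- t) (x - y))).
  rewrite -RintegralD//; [|exact: (integrableZl measurableT (2^-1) (ic _ _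
    _))..].
  apply: eq_Rintegral => u _; rewrite cosM.
  by congr (_ * cos _ + _ * cos _); ring.
rewrite !cf.
(* [E] collects the variance terms common to both expectations. Apart from their angles [A + B] and
   [A - B], these differ only in the sign of [s * t * kappa]. *)
pose E := expR (- (s ^+ 2 * v / 2)) * expR (- (t ^+ 2 * w / 2)).
pose A := s * m + x; pose B := t * n + y.
have -> : expR (- ((s ^+ 2 * v + 2 * (s * t) * kappa + t ^+ 2 * w) / 2)) =
    E * expR (- (s * t * kappa)).
  by rewrite /E -!expRD; congr expR; field.
have -> : expR (- ((s ^+ 2 * v + 2 * (s * - t) * kappa + (- t) ^+ 2 * w) / 2)) =
    E * expR (s * t * kappa).
  by rewrite /E -!expRD; congr expR; field.
have -> : s * m + t * n + (x + y) = A + B by rewrite /A /B; ring.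
have -> : s * m + - t * n + (x - y) = A - B by rewrite /A /B; ring.
have ce (z : R) : series (exp_coeff z) n @[n --> \oo] --> expR z.
  exact: is_cvg_series_exp_coeff.
have -> : mehler_sum rho (trig_coef Y [:: (1, s, x)]) (trig_coef Z [:: (1, t,
  y)]) =
    (fun N => E * (2^-1 * cos (A - B)) * series (exp_coeff (s * t * kappa)) N +
              E * (2^-1 * cos (A + B)) * series (exp_coeff (- (s * t *
                kappa))) N).
  apply/funext => N; rewrite /mehler_sum !mulr_sumr -big_split.
  apply: eq_bigr => k _; rewrite /trig_coef !big_seq1 /= /exp_coeff /=.
  rewrite -/m -/n -/v -/w -/A -/B kE !mul1r.
  rewrite [LHS](_ : _ = E * ((s * t * (rho * L20_norm P Y * L20_norm P Z)) ^+
    k / k`!%:R) *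
    (cos (A + k%:R * (pi / 2)) * cos (B + k%:R * (pi / 2)))); last first.
    by rewrite /E !exprMn; ring.
  by rewrite cosM_shift (exprNn (s * t * _)); ring.
rewrite [X in _ --> X](_ : _ = E * (2^-1 * cos (A - B)) * expR (s * t * kappa) +
   E * (2^-1 * cos (A + B)) * expR (- (s * t * kappa))); last by ring.
by apply: cvgD; apply: cvgM;
  [exact: cvg_cst|exact: ce|exact: cvg_cst|exact: ce].
Qed.

Lemma trig_coef_cat (V : T -> R) q r k :
  trig_coef V (q ++ r) k = trig_coef V q k + trig_coef V r k.
Proof. by rewrite /trig_coef big_cat. Qed.

Lemma trig_coef1 (V : T -> R) c s x k :
  trig_coef V [:: (c, s, x)] k = c * trig_coef V [:: (1, s, x)] k.
Proof. by rewrite /trig_coef !big_seq1 /= mul1r !mulrA. Qed.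

Lemma mehler_sumDl (u u' v : nat -> R) (c c' : R) N :
  mehler_sum rho (fun k => c * u k + c' * u' k) v N =
  c * mehler_sum rho u v N + c' * mehler_sum rho u' v N.
Proof.
by rewrite /mehler_sum !mulr_sumr -big_split; apply: eq_bigr => k _ /=; ring.
Qed.

Lemma mehler_sumDr (u v v' : nat -> R) (c c' : R) N :
  mehler_sum rho u (fun k => c * v k + c' * v' k) N =
  c * mehler_sum rho u v N + c' * mehler_sum rho u v' N.
Proof.
by rewrite /mehler_sum !mulr_sumr -big_split; apply: eq_bigr => k _ /=; ring.
Qed.

Lemma integrable_trigM (q r : seq (R * R * R)) :
  P.-integrable setT (fun w => (trig_poly q (Y w) * trig_poly r (Z w))%:E).
Proof.
have [C qC] := trig_poly_bounded q; have [D rD] := trig_poly_bounded r.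
apply: (@bounded_integrable _ _ _ P _ (C * D)).
  by apply: measurable_funM; apply: measurableT_comp => //;
    exact: measurable_trig_poly.
by move=> w; rewrite normrM ler_pM.
Qed.

Lemma mehler_trig (q r : seq (R * R * R)) :
  mehler_sum rho (trig_coef Y q) (trig_coef Z r) n @[n --> \oo] -->
  \int[P]_w (trig_poly q (Y w) * trig_poly r (Z w)).
Proof.
have nilE (V : T -> R) : trig_coef V [::] = fun=> 0.
  by apply/funext => k; rewrite /trig_coef big_nil.
have consE (V : T -> R) c s x p :
    trig_coef V ((c, s, x) :: p) =
      fun k => c * trig_coef V [:: (1, s, x)] k + 1 * trig_coef V p k.
  by apply/funext => k; rewrite mul1r -trig_coef1 -trig_coef_cat.
have trig1 s x z : trig_poly [:: (1, s, x)] z = cos (s * z + x).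
  by rewrite /trig_poly big_seq1 /= mul1r.
have tcons c s x p z : trig_poly ((c, s, x) :: p) z =
  c * trig_poly [:: (1, s, x)] z + trig_poly p z.
  by rewrite trig1 /trig_poly big_cons.
elim: q => [|[[c s] x] q IHq].
  rewrite nilE (_ : mehler_sum _ _ _ = fun=> 0); last first.
    by apply/funext => N; rewrite /mehler_sum big1// => k _;
      rewrite mul0r mulr0.
  under eq_Rintegral do rewrite /trig_poly big_nil mul0r.
  by rewrite Rintegral_cst// mul0r; exact: cvg_cst.
(* The explicit factor 1 matches the two-coefficient form of [mehler_sumDl]; the single cosine on
   the left is treated by an inner induction on [r]. *)
have {}IHq : c * mehler_sum rho (trig_coef Y [:: (1, s, x)]) (trig_coef Z r) n +
     1 * mehler_sum rho (trig_coef Y q) (trig_coef Z r) n @[n --> \oo] -->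
    c * \int[P]_w (trig_poly [:: (1, s, x)] (Y w) * trig_poly r (Z w)) +
    1 * \int[P]_w (trig_poly q (Y w) * trig_poly r (Z w)).
  apply: cvgD; apply: cvgM; [exact: cvg_cst| |exact: cvg_cst|exact: IHq].
  elim: r {IHq} => [|[[e t] y] r IHr].
    rewrite nilE (_ : mehler_sum _ _ _ = fun=> 0); last first.
      by apply/funext => N; rewrite /mehler_sum big1// => k _; rewrite !mulr0.
    under eq_Rintegral do rewrite [trig_poly [::] _]big_nil mulr0.
    by rewrite Rintegral_cst// mul0r; exact: cvg_cst.
  rewrite consE.
  have -> : \int[P]_w (trig_poly [:: (1, s, x)] (Y w) * trig_poly ((e, t,
    y) :: r) (Z w)) =
      e * \int[P]_w (trig_poly [:: (1, s, x)] (Y w) * trig_poly [:: (1, t,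
        y)] (Z w)) +
      1 * \int[P]_w (trig_poly [:: (1, s, x)] (Y w) * trig_poly r (Z w)).
    rewrite mul1r -RintegralZl//; last exact: integrable_trigM.
    rewrite -RintegralD//; [|exact: (integrableZl measurableT e
      (integrable_trigM _ _))|exact: integrable_trigM].
    by apply: eq_Rintegral => w _; rewrite [trig_poly (_ :: r) _]tcons; ring.
  rewrite (_ : mehler_sum _ _ _ = fun N =>
     e * mehler_sum rho (trig_coef Y [:: (1, s, x)]) (trig_coef Z [:: (1, t,
       y)]) N +
     1 * mehler_sum rho (trig_coef Y [:: (1, s, x)]) (trig_coef Z r) N);
       last first.
    by apply/funext => N; exact: mehler_sumDr.
  apply: cvgD; apply: cvgM; [exact: cvg_cst| |exact: cvg_cst|exact: IHr].
  have := @mehler_cos s x t y.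
  by under eq_Rintegral do rewrite -!trig1.
rewrite consE.
have -> : \int[P]_w (trig_poly ((c, s, x) :: q) (Y w) * trig_poly r (Z w)) =
    c * \int[P]_w (trig_poly [:: (1, s, x)] (Y w) * trig_poly r (Z w)) +
    1 * \int[P]_w (trig_poly q (Y w) * trig_poly r (Z w)).
  rewrite mul1r -RintegralZl//; last exact: integrable_trigM.
  rewrite -RintegralD//; [|exact: (integrableZl measurableT c
    (integrable_trigM _ _))|exact: integrable_trigM].
  by apply: eq_Rintegral => w _; rewrite [trig_poly (_ :: q) _]tcons; ring.
rewrite (_ : mehler_sum _ _ _ = fun N =>
   c * mehler_sum rho (trig_coef Y [:: (1, s, x)]) (trig_coef Z r) N +
   1 * mehler_sum rho (trig_coef Y q) (trig_coef Z r) N) //.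
by apply/funext => N; exact: mehler_sumDl.
Qed.

Lemma integral_trig (q : seq (R * R * R)) :
  \int[P]_w trig_poly q (Y w) = trig_coef Y q 0.
Proof.
have [Y2 cf] := bivariate_gaussian_moments mY mZ YZ.
have it (t u : R) : P.-integrable setT (fun w => (cos (t * Y w + u))%:E).
  apply: (@bounded_integrable _ _ _ P _ 1); last by move=> w;
    exact: normr_cos_le1.
  exact: measurableT_comp (measurable_cosaff t u) mY.
elim: q => [|[[c s] x] q IHq].
  rewrite /trig_coef big_nil.
  under eq_Rintegral do rewrite /trig_poly big_nil.
  by rewrite Rintegral_cst// mul0r.
rewrite -cat1s trig_coef_cat -IHq trig_coef1.
have -> : trig_coef Y [:: (1, s, x)] 0 = \int[P]_w cos (s * Y w + x).
  have := cf s 0 x.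
  under eq_Rintegral do rewrite mul0r addr0.
  move=> ->; rewrite /trig_coef big_seq1 /= expr0 mulr1 mul1r [LHS]mulrC.
  by congr (cos _ * expR _); field.
have it' : P.-integrable setT (fun w => (cos (s * Y w + x))%:E) := it s x.
rewrite -(RintegralZl c measurableT it') -RintegralD//.
- by apply: eq_Rintegral => w _; rewrite trig_poly_cat /trig_poly big_seq1.
- exact: (integrableZl measurableT c it').
- have [C qC] := trig_poly_bounded q.
  apply: (@bounded_integrable _ _ _ P _ C) => //.
  exact: measurableT_comp (measurable_trig_poly q) mY.
Qed.

End Pair.
End Mehler.

(** * Variance of a sum of functions of Gaussian variables *)

Section FiniteSums.
Context {R : realType}.

Lemma cvg_bigsum (I : Type) (s : seq I) (F : I -> nat -> R) (l : I -> R) :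
  (forall i, F i n @[n --> \oo] --> l i) ->
  (\sum_(i <- s) F i n) @[n --> \oo] --> \sum_(i <- s) l i.
Proof.
move=> Fl; elim: s => [|i s IH].
  rewrite big_nil (_ : (fun n => _) = fun=> 0); first exact: cvg_cst.
  by apply/funext => n; rewrite big_nil.
rewrite big_cons (_ : (fun n => _) = fun n => F i n + \sum_(j <- s) F j n).
  by apply: cvgD => //; exact: Fl.
by apply/funext => n; rewrite big_cons.
Qed.

Context {d : measure_display} {T : measurableType d}.
Variable P : probability T R.

Lemma integrable_bigsum (I : Type) (s : seq I) (F : I -> T -> R) :
  (forall i, P.-integrable setT (EFin \o F i)) ->
  P.-integrable setT (EFin \o (fun w => \sum_(i <- s) F i w)).
Proof.
move=> Fi; elim: s => [|i s IH].
  rewrite (_ : _ \o _ = fun=> (0 : R)%:E).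
    by apply: (@bounded_integrable _ _ _ P (cst 0) 0) => // w; rewrite normr0.
  by apply/funext => w /=; rewrite big_nil.
rewrite (_ : _ \o _ = EFin \o (fun w => F i w + \sum_(j <- s) F j w)).
  exact: (integrableD measurableT (Fi i) IH).
by apply/funext => w /=; rewrite big_cons.
Qed.

Lemma Rintegral_bigsum (I : Type) (s : seq I) (F : I -> T -> R) :
  (forall i, P.-integrable setT (EFin \o F i)) ->
  \int[P]_w (\sum_(i <- s) F i w) = \sum_(i <- s) \int[P]_w F i w.
Proof.
move=> Fi; elim: s => [|i s IH].
  under eq_Rintegral do rewrite big_nil.
  by rewrite Rintegral_cst// mul0r big_nil.
rewrite big_cons -IH -RintegralD//; last exact: integrable_bigsum.
by apply: eq_Rintegral => w _; rewrite big_cons.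
Qed.

Lemma Lfun2_sum (I : Type) (s : seq I) (F : I -> T -> R) :
  (forall i, F i \in Lfun P 2%:E) ->
  (fun w => \sum_(i <- s) F i w) \in Lfun P 2%:E.
Proof.
move=> F2; elim: s => [|i s IH].
  rewrite (_ : (fun w => _) = cst 0); first exact: Lfun_cst.
  by apply/funext => w; rewrite big_nil.
rewrite (_ : (fun w => _) = F i \+ (fun w => \sum_(j <- s) F j w)).
  by rewrite rpredD ?lee1n.
by apply/funext => w; rewrite big_cons.
Qed.

End FiniteSums.

(** * Schur products with a Gram matrix *)

Section Schur.
Context {d : measure_display} {T : measurableType d} {R : realType} {p : nat}.
Variables (P : probability T R) (Y : 'I_p -> T -> R) (C : 'M[R]_p).
Hypothesis iY : forall j k, P.-integrable setT (fun w => (Y j w * Y k w)%:E).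
Hypothesis CE : forall j k, C j k = \int[P]_w (Y j w * Y k w).

(* The form of the entrywise product is the expectation of the form of [A] at
   the random vector [(x_j Y_j)_j]. *)
Lemma psd_schur (A : 'M[R]_p) : psd A -> psd (\matrix_(j, k) (A j k * C j k)).
Proof.
move=> pA x.
have i1 j k : P.-integrable setT
    (EFin \o (fun w => A j k * (x 0 j * Y j w) * (x 0 k * Y k w))).
  rewrite (_ : _ \o _ = (fun w =>
    ((A j k * x 0 j * x 0 k)%:E * (Y j w * Y k w)%:E)%E)).
    exact: integrableZl.
  by apply/funext => w /=; rewrite -EFinM; congr EFin; ring.
rewrite (_ : bform _ x x = \int[P]_w bform A (\row_j (x 0 j * Y j w)) (\row_j
  (x 0 j * Y j w))).
  by apply: Rintegral_ge0 => w _; exact: pA.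
rewrite /bform.
transitivity (\int[P]_w \sum_j \sum_k A j k * (x 0 j * Y j w) * (x 0 k * Y k
  w)); last first.
  by apply: eq_Rintegral => w _; apply: eq_bigr => j _; apply: eq_bigr => k _;
    rewrite !mxE.
rewrite Rintegral_bigsum; last by move=> j; exact: integrable_bigsum.
apply: eq_bigr => j _; rewrite Rintegral_bigsum//; apply: eq_bigr => k _.
rewrite mxE CE -mulrA -mulrA (mulrC (\int[P]_w _)) !mulrA -(RintegralZl _
  measurableT (iY j k)).
by apply: eq_Rintegral => w _; ring.
Qed.

(** Entrywise multiplication by [C] raises the power by one and, the diagonal of [C] being 1, leaves
    the multiple of the identity unchanged. One [lambda], of either sign, therefore serves all
    orders [m.+1]. *)
Lemma psd_schur_pow (lambda : R) (m : nat) :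
  (forall j, C j j = 1) -> psd (C - lambda%:M) ->
  psd (\matrix_(j, k) (C j k ^+ m.+1 - lambda *+ (j == k))).
Proof.
move=> C1 pC; elim: m => [|m IH].
  rewrite (_ : \matrix_(j, k) _ = C - lambda%:M)//.
  by apply/matrixP => j k; rewrite !mxE expr1.
rewrite (_ : \matrix_(j, k) _ = \matrix_(j, k)
  ((\matrix_(j, k) (C j k ^+ m.+1 - lambda *+ (j == k))) j k * C j k)).
  exact: psd_schur.
apply/matrixP => j k; rewrite !mxE mulrBl -exprSr.
by case: eqVneq => [->|_]; rewrite ?C1 ?mulr1// !mulr0n mul0r.
Qed.

End Schur.

Section GaussianFamily.
Context {d : measure_display} {T : measurableType d} {R : realType} {p : nat}.
Variables (P : probability T R) (Z : 'I_p -> T -> R).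
Hypothesis mZ : forall j, measurable_fun setT (Z j).
Hypothesis gZ : pairwise_gaussian P Z.
Hypothesis Z0 : forall j, L20_norm P (Z j) != 0.

Let C := corr_mx P Z.

Let Z2 j : Z j \in Lfun P 2%:E.
Proof. by have [] := bivariate_gaussian_moments (mZ j) (mZ j) (gZ j j). Qed.

Let Y j w := (Z j w - \int[P]_w Z j w) / L20_norm P (Z j).

Lemma corr_mx_sym : C^T = C.
Proof.
apply/matrixP => j k; rewrite !mxE /correlation covarianceC.
by rewrite [X in _ / X]mulrC.
Qed.

Lemma corr_mx_diag j : C j j = 1.
Proof.
rewrite mxE /correlation -/(variance P (Z j)) -/(L20_norm P (Z j)).
by rewrite -expr2 sqr_L20_norm divff// -sqr_L20_norm sqrf_eq0.
Qed.

Let cZ2 j : (fun w => Z j w - \int[P]_w Z j w) \in Lfun P 2%:E.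
Proof.
rewrite (_ : (fun w => _) = Z j \- cst (\int[P]_w Z j w))//.
by rewrite rpredB ?lee1n//= => _; exact: Lfun_cst.
Qed.

Let Y2 j : Y j \in Lfun P 2%:E.
Proof.
rewrite (_ : Y j = (L20_norm P (Z j))^-1 \o* (fun w =>
  Z j w - \int[P]_w Z j w))//.
by rewrite Lfun_scale// ler1n.
Qed.

(** Correlations as second moments of the standardized variables: the Gram form required by Schur's
    theorem. *)
Lemma corr_mx_gram j k : C j k = \int[P]_w (Y j w * Y k w).
Proof.
have i := Lfun2_integrableM (cZ2 j) (cZ2 k).
transitivity (\int[P]_w ((L20_norm P (Z j) * L20_norm P (Z k))^-1 *
    ((Z j w - \int[P]_w Z j w) * (Z k w - \int[P]_w Z k w)))); last first.
  apply: eq_Rintegral => w _; rewrite /Y; field.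
  by rewrite !Z0.
rewrite RintegralZl// mulrC mxE /correlation; congr (_ / _).
by rewrite covariance.unlock expectation.unlock.
Qed.

Lemma psd_corr_pow (lambda : R) (m : nat) : psd (C - lambda%:M) ->
  psd (\matrix_(j, k) (C j k ^+ m.+1 - lambda *+ (j == k))).
Proof.
move=> pC; apply: (@psd_schur_pow _ _ _ _ P Y) => //.
- by move=> j k; exact: Lfun2_integrableM.
- exact: corr_mx_gram.
- exact: corr_mx_diag.
Qed.

Lemma Lfun2_trig (q : seq (R * R * R)) j :
  (fun w => trig_poly q (Z j w)) \in Lfun P 2%:E.
Proof.
have [D qD] := trig_poly_bounded q.
have mq : measurable_fun setT (fun w => trig_poly q (Z j w)).
  exact: measurableT_comp (measurable_trig_poly q) (mZ j).
apply: Lfun2_of_sqr => //; apply: (@bounded_integrable _ _ _ P _ (D ^+ 2)).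
  exact: measurable_funX.
move=> w; rewrite normrX ler_sqr ?nnegrE//.
by apply: le_trans (qD 0).
Qed.

(* Mehler's formula turns the covariances of the [q_j (Z_j)] into
   [sum_m rho_jk ^ m / m! * a_jm * a_km] over [m >= 1], and each term is
   controlled by the Schur powers of the correlation matrix. *)
Lemma trig_poly_variance_sum (lambda : R) (q : 'I_p -> seq (R * R * R)) :
  psd (C - lambda%:M) ->
  lambda * \sum_j fine 'V_P[fun w => trig_poly (q j) (Z j w)] <=
  fine 'V_P[fun w => \sum_j trig_poly (q j) (Z j w)].
Proof.
move=> pC; pose a j := trig_coef P (Z j) (q j).
pose F j w := trig_poly (q j) (Z j w).
have F2 j : F j \in Lfun P 2%:E by exact: Lfun2_trig.
pose c j k := \int[P]_w (F j w * F k w) - a j 0%N * a k 0%N.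
have VE j : fine 'V_P[F j] = c j j.
  by rewrite /variance fine_covarianceE// /c /F (integral_trig (mZ j) (mZ j)
    (gZ j j)).
have VSE : fine 'V_P[fun w => \sum_j F j w] = \sum_j \sum_k c j k.
  rewrite /variance fine_covarianceE ?Lfun2_sum//.
  rewrite Rintegral_bigsum; last by move=> j; exact: Lfun2_integrable.
  transitivity (\sum_j \sum_k \int[P]_w (F j w * F k w) - \sum_j \sum_k (a j
    0%N * a k 0%N)).
    congr (_ - _).
      have iFF j k : P.-integrable setT (EFin \o (fun w => F j w * F k w)).
        exact: Lfun2_integrableM.
      transitivity (\int[P]_w \sum_j \sum_k (F j w * F k w)).
        by apply: eq_Rintegral => w _; rewrite mulr_suml;
          apply: eq_bigr => j _; rewrite mulr_sumr.
      rewrite Rintegral_bigsum; last by move=> j; exact: integrable_bigsum.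
      by apply: eq_bigr => j _; rewrite Rintegral_bigsum.
    rewrite mulr_suml; apply: eq_bigr => j _; rewrite mulr_sumr;
      apply: eq_bigr => k _.
    by rewrite /F (integral_trig (mZ j) (mZ j) (gZ j j)) (integral_trig (mZ k)
      (mZ k) (gZ k k)).
  by rewrite -sumrB; apply: eq_bigr => j _; rewrite -sumrB.
(* Index [m] stands for order [m.+1]; order 0 is the product of the means already subtracted in
   [c]. *)
pose D j k N := \sum_(0 <= m < N) C j k ^+ m.+1 / (m.+1)`!%:R * (a j m.+1 * a
  k m.+1).
have Dc j k : D j k N @[N --> \oo] --> c j k.
  have := @mehler_trig _ _ _ P _ _ (mZ j) (mZ k) (gZ j k) (Z0 j) (Z0 k) (q j)
    (q k).
  rewrite -cvg_shiftS /= => h.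
  have : mehler_sum (correlation P (Z j) (Z k)) (a j) (a k) N.+1 - a j 0%N * a
    k 0%N @[N --> \oo] --> c j k.
    by apply: cvgB; [exact: h|exact: cvg_cst].
  apply: cvg_trans; apply: near_eq_cvg; apply: nearW => N.
  rewrite /mehler_sum big_nat_recl// expr0 fact0 divr1 mul1r addrC addKr.
  by rewrite /D /C; apply: eq_bigr => m _; rewrite mxE.
rewrite -/(F _) VSE.
have -> : \sum_j fine 'V_P[fun w => trig_poly (q j) (Z j w)] = \sum_j c j j.
  by apply: eq_bigr => j _; exact: VE.
have c1 : lambda * \sum_j D j j N @[N --> \oo] --> lambda * \sum_j c j j.
  by apply: cvgM; [exact: cvg_cst|apply: cvg_bigsum => j; exact: Dc].
have c2 : \sum_j \sum_k D j k N @[N --> \oo] --> \sum_j \sum_k c j k.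
  by apply: cvg_bigsum => j; apply: cvg_bigsum => k; exact: Dc.
(* It is enough to compare partial sums: for each [N] the difference is a finite nonnegative
   combination of forms whose matrices are the entrywise powers minus [lambda] times the
   identity. *)
apply: (ler_cvg_to c1 c2); apply: nearW => N.
rewrite -subr_ge0.
rewrite (_ : _ - _ = \sum_(0 <= m < N) (m.+1)`!%:R^-1 *
  bform (\matrix_(j, k) (C j k ^+ m.+1 - lambda *+ (j == k)))
    (\row_j a j m.+1) (\row_j a j m.+1)).
  by apply: sumr_ge0 => m _; rewrite mulr_ge0// ?psd_corr_pow.
rewrite /D mulr_sumr.
under eq_bigr do rewrite exchange_big /=.
rewrite exchange_big /=.
under [X in _ - X]eq_bigr do rewrite mulr_sumr.
rewrite [X in _ - X]exchange_big /= -sumrB; apply: eq_bigr => m _.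
rewrite -sumrB mulr_sumr; apply: eq_bigr => j _.
have rowE i : (\row_j a j m.+1 : 'rV_p) 0 i = a i m.+1 by rewrite mxE.
have matE i k : (\matrix_(j, k) (C j k ^+ m.+1 - lambda *+ (j == k))) i k =
    C i k ^+ m.+1 - lambda *+ (i == k) by rewrite mxE.
(* [lambda] sits on the diagonal only, so the term [k = j] is compared apart from the others. *)
rewrite (bigD1 j)//= [in RHS](bigD1 j)//= !rowE !matE eqxx mulr1n corr_mx_diag
  expr1n mulrDr addrAC.
congr (_ + _); first by ring.
rewrite mulr_sumr; apply: eq_bigr => k kj;
  rewrite rowE matE eq_sym (negbTE kj) mulr0n.
by ring.
Qed.

End GaussianFamily.

(** * The variance seminorm *)

Section L20Seminorm.
Context {d : measure_display} {T : measurableType d} {R : realType}.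
Variable P : probability T R.
Implicit Types X Y : T -> R.

Lemma L20_norm_ge0 X : 0 <= L20_norm P X.
Proof. exact: sqrtr_ge0. Qed.

Lemma L20_normD X Y : X \in Lfun P 2%:E -> Y \in Lfun P 2%:E ->
  L20_norm P (X \+ Y) <= L20_norm P X + L20_norm P Y.
Proof.
move=> X2 Y2.
have VX := variance_fin_num X2; have VY := variance_fin_num Y2.
have CXY : covariance P X Y \is a fin_num.
  apply: covariance_fin_num; [exact/Lfun1_integrable/Lfun2_integrable..|].
  exact: Lfun2_mul_Lfun1.
rewrite -ler_sqr ?nnegrE ?addr_ge0 ?L20_norm_ge0// sqr_L20_norm sqrrD
  !sqr_L20_norm.
rewrite varianceD// !fineD ?fineM ?fin_numM ?fin_numD ?VX ?VY ?CXY//=.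
rewrite addrAC lerD2r lerD2l -[leRHS]mulr_natl ler_pM2l//.
have sE (V : T -> R) : 'V_P[V]%E \is a fin_num -> sqrte 'V_P[V]%E =
  (L20_norm P V)%:E.
  by move=> Vf; rewrite -[in LHS](fineK Vf).
have := covariance_le X2 Y2.
by rewrite (sE _ VX) (sE _ VY) -(fineK CXY) -EFinM lee_fin.
Qed.

Lemma L20_normN X : X \in Lfun P 2%:E -> L20_norm P (\- X) = L20_norm P X.
Proof. by move=> X2; rewrite /L20_norm varianceN. Qed.

Lemma L20_norm_sum (I : Type) (s : seq I) (F : I -> T -> R) :
  (forall i, F i \in Lfun P 2%:E) ->
  L20_norm P (fun w => \sum_(i <- s) F i w) <= \sum_(i <- s) L20_norm P (F i).
Proof.
move=> F2; elim: s => [|i s IH].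
  rewrite big_nil (_ : (fun w => _) = cst 0).
    by rewrite /L20_norm variance_cst sqrtr0.
  by apply/funext => w; rewrite big_nil.
rewrite big_cons (_ : (fun w => _) = F i \+ (fun w => \sum_(j <- s) F j w)).
  by apply: le_trans (L20_normD _ _) _ => //; [exact: Lfun2_sum|rewrite lerD2l].
by apply/funext => w; rewrite big_cons.
Qed.

(** The variance is at most the second moment, so density in L^2 passes to the seminorm. *)
Lemma L20_norm_le_sqr X (e : R) : 0 < e -> X \in Lfun P 2%:E ->
  (\int[P]_w (X w ^+ 2)%:E < (e ^+ 2)%:E)%E -> L20_norm P X <= e.
Proof.
move=> /ltW e0 X2 Xe; rewrite -ler_sqr ?nnegrE ?L20_norm_ge0// sqr_L20_norm.
rewrite /variance fine_covarianceE//.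
apply: (@le_trans _ _ (\int[P]_w (X w * X w)));
  first by rewrite gerBl -expr2 sqr_ge0.
rewrite /Rintegral -lee_fin fineK; first exact: ltW.
exact/integrable_fin_num/Lfun2_integrableM.
Qed.

(** [c] is the real number by which ['V_P[X]] centres [X], a default value if the mean is not
    finite. Finite variance says that [X - c] is square integrable whatever [c] is, and adding a
    constant gives [X]. *)
Lemma Lfun2_of_variance X : measurable_fun setT X -> ('V_P[X] < +oo)%E ->
  X \in Lfun P 2%:E.
Proof.
move=> mX VX; set c := fine (\int[P]_w (X w)%:E)%E.
have : (fun w => X w - c) \in Lfun P 2%:E.
  apply: Lfun2_of_sqr; first exact: measurable_funB.
  apply/integrableP; split.
    by apply/measurable_EFinP; apply: measurable_funX; exact: measurable_funB.
  move: VX; rewrite /variance covariance.unlock expectation.unlock -/c.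
  congr (_ < _)%E; apply: eq_integral => w _.
  by rewrite gee0_abs ?lee_fin ?sqr_ge0.
move=> h; have -> : X = (fun w => X w - c) \+ cst c.
  by apply/funext => w /=; rewrite subrK.
by rewrite rpredD ?lee1n//= => _; exact: Lfun_cst.
Qed.

End L20Seminorm.

(** * From trigonometric polynomials to square-integrable functions *)

Section VarianceOfSum.
Context {d : measure_display} {T : measurableType d} {R : realType} {p : nat}.
Variables (P : probability T R) (Z : 'I_p -> T -> R).
Hypothesis mZ : forall j, measurable_fun setT (Z j).
Hypothesis gZ : pairwise_gaussian P Z.
Hypothesis Z0 : forall j, L20_norm P (Z j) != 0.

Lemma trig_poly_L20_dense (f : R -> R) j (e : R) : 0 < e ->
  measurable_fun setT f -> f \o Z j \in Lfun P 2%:E ->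
  exists q, L20_norm P (fun w => f (Z j w) - trig_poly q (Z j w)) <= e.
Proof.
move=> e0 mf f2.
have [q qe] := trig_poly_dense (mZ j) mf (Lfun2_integrable_sqr f2) (exprn_gt0
  2 e0).
exists q; apply: L20_norm_le_sqr => //.
rewrite (_ : (fun w => _) = (f \o Z j) \- (fun w => trig_poly q (Z j w)))//.
by rewrite rpredB ?lee1n//= => _; exact: Lfun2_trig.
Qed.

(** The inequality for approximants passes to the limit. Each seminorm on the left converges, by the
    reverse triangle inequality, which is insensitive to the sign of [lambda]; on the right a
    convergent upper bound is enough. *)
Lemma gaussian_variance_sum (lambda : R) (f : 'I_p -> R -> R) :
  psd (corr_mx P Z - lambda%:M) ->
  (forall j, measurable_fun setT (f j)) ->
  (forall j, f j \o Z j \in Lfun P 2%:E) ->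
  lambda * \sum_j L20_norm P (f j \o Z j) ^+ 2 <=
  L20_norm P (fun w => \sum_j f j (Z j w)) ^+ 2.
Proof.
move=> pC mf f2.
have eps0 n : 0 < n.+1%:R^-1 :> R by rewrite invr_gt0.
have /choice[q qP] : forall nj : nat * 'I_p, exists q, L20_norm P
    (fun w => f nj.2 (Z nj.2 w) - trig_poly q (Z nj.2 w)) <= nj.1.+1%:R^-1.
  by move=> [n j] /=; exact: trig_poly_L20_dense.
pose Q n j w := trig_poly (q (n, j)) (Z j w).
have Q2 n j : Q n j \in Lfun P 2%:E by exact: Lfun2_trig.
have D2 n j : (fun w => f j (Z j w) - Q n j w) \in Lfun P 2%:E.
  rewrite (_ : (fun w => _) = (f j \o Z j) \- Q n j)//.
  by rewrite rpredB ?lee1n.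
have D2' n j : (fun w => Q n j w - f j (Z j w)) \in Lfun P 2%:E.
  rewrite (_ : (fun w => _) = Q n j \- (f j \o Z j))//.
  by rewrite rpredB ?lee1n.
have De' n j : L20_norm P (fun w => Q n j w - f j (Z j w)) <= n.+1%:R^-1.
  rewrite -L20_normN// (_ : \- _ = fun w => f j (Z j w) - Q n j w).
    exact: (qP (n, j)).
  by apply/funext => w /=; rewrite opprB.
have cv0 : n.+1%:R^-1 @[n --> \oo] --> (0 : R) by exact: cvg_harmonic.
have cvQ j : L20_norm P (Q n j) @[n --> \oo] --> L20_norm P (f j \o Z j).
  apply/subr_cvg0; apply: norm_cvg0.
  apply: (@squeeze_cvgr nat \oo _ R (fun=> 0) (fun n => n.+1%:R^-1)
    (fun n => `|L20_norm P (Q n j) - L20_norm P (f j \o Z j)|)) => //;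
      last exact: cvg_cst.
  apply: nearW => n; rewrite normr_ge0 /= ler_norml; apply/andP; split.
    rewrite lerNl opprB lerBlDr.
    have := L20_normD (D2 n j) (Q2 n j).
    rewrite (_ : _ \+ _ = f j \o Z j); last by apply/funext => w /=;
      rewrite subrK.
    by move=> /le_trans; apply; rewrite lerD2r; exact: (qP (n, j)).
  rewrite lerBlDr.
  have := L20_normD (D2' n j) (f2 j).
  rewrite (_ : _ \+ _ = Q n j); last by apply/funext => w /=; rewrite subrK.
  by move=> /le_trans; apply; rewrite lerD2r.
set A := L20_norm P (fun w => \sum_j f j (Z j w)).
have c1 : lambda * \sum_j L20_norm P (Q n j) ^+ 2 @[n --> \oo] -->
    lambda * \sum_j L20_norm P (f j \o Z j) ^+ 2.
  apply: cvgM; first exact: cvg_cst.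
  by apply: cvg_bigsum => j; apply: cvgM; exact: cvQ.
(* The approximating sum exceeds [A] in seminorm by at most [p] errors, each bounded by
   [n.+1%:R^-1]. *)
have c2 : (A + p%:R * n.+1%:R^-1) ^+ 2 @[n --> \oo] --> A ^+ 2.
  rewrite (_ : A ^+ 2 = (A + p%:R * 0) ^+ 2); last by rewrite mulr0 addr0.
  have h : A + p%:R * n.+1%:R^-1 @[n --> \oo] --> A + p%:R * 0.
    by apply: cvgD; [exact: cvg_cst|apply: cvgM => //; exact: cvg_cst].
  by have := cvgM h h => /(_ _) h2; exact: h2.
apply: (ler_cvg_to c1 c2); apply: nearW => n.
apply: (@le_trans _ _ (L20_norm P (fun w => \sum_j Q n j w) ^+ 2)).
  have := trig_poly_variance_sum mZ gZ Z0 (fun j => q (n, j)) pC.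
  rewrite sqr_L20_norm; apply: le_trans; rewrite le_eqVlt; apply/orP; left;
    apply/eqP.
  by congr (_ * _); apply: eq_bigr => j _; rewrite sqr_L20_norm.
rewrite ler_sqr ?nnegrE ?L20_norm_ge0//; last first.
  by rewrite addr_ge0 ?L20_norm_ge0// mulr_ge0.
have F2 : (fun w => \sum_j f j (Z j w)) \in Lfun P 2%:E by exact: Lfun2_sum.
have S2 : (fun w => \sum_j (Q n j w - f j (Z j w))) \in Lfun P 2%:E by exact:
  Lfun2_sum.
have := L20_normD F2 S2.
rewrite (_ : _ \+ _ = fun w => \sum_j Q n j w); last first.
  by apply/funext => w /=; rewrite -big_split; apply: eq_bigr => j _ /=;
    rewrite subrKC.
move=> /le_trans; apply; rewrite lerD2l.
apply: le_trans (L20_norm_sum _ _) _ => //.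
apply: le_trans (ler_sum _ (fun j _ => De' n j)) _.
by rewrite sumr_const card_ord mulr_natl.
Qed.

End VarianceOfSum.

(** Cauchy-Schwarz against the indicator of [I], through Lagrange's identity. The cardinal is the
    normalizing factor of the case [q = 1], and the sum over all indices is the one bounded by the
    variance inequality. *)
Lemma sqr_sum_le_card (R : realType) (p : nat) (I : {set 'I_p}) (a :
  'I_p -> R) :
  (\sum_(j in I) a j) ^+ 2 <= #|I|%:R * \sum_j a j ^+ 2.
Proof.
have aI : \sum_(j in I) a j ^+ 2 <= \sum_j a j ^+ 2.
  rewrite [leRHS](bigID [pred j | j \in I])/= lerDl.
  by apply: sumr_ge0 => j _; exact: sqr_ge0.
apply: le_trans (ler_wpM2l _ aI) => //.
have : 0 <= \sum_(j in I) \sum_(k in I) (a j - a k) ^+ 2.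
  by apply: sumr_ge0 => j _; apply: sumr_ge0 => k _; exact: sqr_ge0.
suff -> : \sum_(j in I) \sum_(k in I) (a j - a k) ^+ 2 =
   2 * (#|I|%:R * \sum_(j in I) a j ^+ 2 - (\sum_(j in I) a j) ^+ 2).
  by rewrite pmulr_rge0// subr_ge0.
transitivity (\sum_(j in I) \sum_(k in I) (a j ^+ 2 + a k ^+ 2 - 2 * (a j * a
  k))).
  by apply: eq_bigr => j _; apply: eq_bigr => k _; ring.
transitivity (\sum_(j in I) (#|I|%:R * a j ^+ 2 + \sum_(k in I) a k ^+ 2 - 2 *
  (a j * \sum_(k in I) a k))).
  apply: eq_bigr => j _; rewrite sumrB big_split /= sumr_const mulr_natl.
  by rewrite mulr_sumr mulr_sumr.
rewrite sumrB big_split /= sumr_const -!mulr_sumr -mulr_suml.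
by rewrite -[(\sum_(k in I) a k ^+ 2) *+ _]mulr_natl; ring.
Qed.

(** * The restricted eigenvalue bound *)

Section PhiStar.
Context {d : measure_display} {T : measurableType d} {R : realType} {p : nat}.
Variables (P : probability T R) (Z X : 'I_p -> {RV P >-> R}) (Tr :
  'I_p -> R -> R).
Variables (I : {set 'I_p}) (Pen : 'I_p -> (R -> R) -> R) (xi0 : R).
Hypothesis hT : forall j, measurable_fun setT (Tr j).
Hypothesis hX : forall j w, X j w = Tr j (Z j w).
Hypothesis hZ : pairwise_gaussian P Z.
Hypothesis hVar : forall j,
  (0 < 'V_P[Tr j \o Z j])%E /\ ('V_P[Tr j \o Z j] < +oo)%E.
Hypothesis hI : I != finset.set0.

Let mZ j : measurable_fun setT (Z j : T -> R).
Proof. exact: measurable_funP. Qed.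

(** A degenerate [Z j] would make [Tr j \o Z j] degenerate too, against its positive variance;
    correlations therefore have nonzero denominators. *)
Let Z0 j : L20_norm P (Z j) != 0.
Proof.
have [Z2 _] := bivariate_gaussian_moments (mZ j) (mZ j) (hZ j j).
apply/eqP => Zj0; have [+ _] := hVar j.
rewrite variance_comp_eq0 ?ltxx//.
by rewrite -sqr_L20_norm Zj0 expr0n.
Qed.

Let lambda := lambda_min (corr_mx P Z).

Lemma L20_norm_additive_ge (f : 'I_p -> R -> R) :
  (forall j, measurable_fun setT (f j)) ->
  (forall j, ('V_P[f j \o X j] < +oo)%E) ->
  lambda * \sum_j L20_norm P (f j \o X j) ^+ 2 <=
  L20_norm P (fun w => \sum_j f j (X j w)) ^+ 2.
Proof.
move=> mf Vf.
(* A nonempty [I] makes the matrix nonempty, as [psd_sub_lambda_min] requires. *)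
have p0 : (0 < p)%N.
  by have /set0Pn[j _] := hI; apply: leq_ltn_trans (ltn_ord j).
have fX j : f j \o X j = (f j \o Tr j) \o Z j.
  by apply/funext => w /=; rewrite hX.
have -> : (fun w => \sum_j f j (X j w)) =
  (fun w => \sum_j (f j \o Tr j) (Z j w)).
  by apply/funext => w; apply: eq_bigr => j _; rewrite hX.
under eq_bigr do rewrite fX.
apply: gaussian_variance_sum => //.
- exact: psd_sub_lambda_min (corr_mx_sym P Z).
- by move=> j; exact: measurableT_comp.
- move=> j; rewrite -fX; apply: Lfun2_of_variance => //.
  exact: measurableT_comp.
Qed.

Lemma phi_star_ge (q : R) (J : {set 'I_p}) :
  (q = 2 /\ J = finset.setT) \/ (q = 1 /\ J = I) ->
  (lambda%:E <= phi_star P X I Pen xi0 q J)%E.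
Proof.
move=> qJ; apply: le_ereal_inf_tmp => _ [f [mf Vf _ den0] <-].
rewrite lee_fin /phi_objective ler_pdivlMr//.
have := L20_norm_additive_ge mf Vf.
set B := L20_norm P _ ^+ 2; set a := fun j => L20_norm P (f j \o X j).
have a0 j : 0 <= a j by exact: L20_norm_ge0.
rewrite -/(\sum_j a j ^+ 2) => lB.
have B0 : 0 <= B by exact: sqr_ge0.
case: qJ den0 => -[-> ->]; rewrite /phi_denominator.
(* For [q = 2] the exponents [2 - q] and [2 / q] are 0 and 1, and the claim is the variance
   inequality itself. *)
- move=> _; rewrite subrr powRr0 mul1r divff// powRr1; last first.
    by apply: sumr_ge0 => j _; exact: powR_ge0.
  apply: le_trans lB; rewrite le_eqVlt; apply/orP; left; apply/eqP.
  congr (_ * _); apply: eq_big => [j|j _]; first by rewrite finset.in_setT.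
  by rewrite powR_mulrn ?L20_norm_ge0.
- move=> _; rewrite divr1 (_ : 2 - 1 = 1); last by ring.
  rewrite powRr1// powR_mulrn; last by apply: sumr_ge0 => j _; exact: powR_ge0.
  under eq_bigr do rewrite powRr1 ?L20_norm_ge0//.
  have cs := sqr_sum_le_card I a.
  (* Cauchy-Schwarz can be scaled by [lambda] only if [lambda] is nonnegative; otherwise the left
     side is at most 0 and the right side at least 0. *)
  have [l0|l0] := leP 0 lambda; last first.
    apply: (@le_trans _ _ 0); last by rewrite mulr_ge0.
    by rewrite nmulr_rle0// sqr_ge0.
  apply: le_trans (ler_wpM2l l0 cs) _.
  by rewrite mulrCA ler_wpM2l.
Qed.

End PhiStar.

Theorem corollary6 (R : realType) (d : measure_display) (Omega : measurableType d)
    (P : probability Omega R) (p : nat)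
    (Z X : 'I_p -> {RV P >-> R}) (T : 'I_p -> R -> R)
    (I : {set 'I_p}) (Pen : 'I_p -> (R -> R) -> R) (xi0 : R)
    (hT : forall j, measurable_fun setT (T j))
    (hX : forall j w, X j w = T j (Z j w))
    (hZ : pairwise_gaussian P Z)
    (hVar : forall j, (0 < 'V_P[T j \o Z j])%E /\ ('V_P[T j \o Z j] < +oo)%E)
    (hI : I != finset.set0)
    (hPen : forall j f, 0 <= Pen j f)
    (hxi0 : 0 < xi0) :
  (forall (q : R) (J : {set 'I_p}),
      (q = 2 /\ J = finset.setT) \/ (q = 1 /\ J = I) ->
      ((lambda_min (corr_mx P Z))%:E <= phi_star P X I Pen xi0 q J)%E) /\
  (forall kappa0 : R, 0 < kappa0 -> kappa0 <= lambda_min (corr_mx P Z) ->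
      theoretical_restricted_eigenvalue_condition P X I Pen xi0 kappa0 /\
      theoretical_compatibility_condition P X I Pen xi0 kappa0).
Proof.
have main := phi_star_ge Pen xi0 hT hX hZ hVar hI.
split=> // kappa0 kappa0_gt0 kappa0_le.
by split; split=> //; apply: le_trans (main _ _ _); rewrite ?lee_fin//; [left|right].
Qed.
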